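(* Let $k$ be an algebraically closed field of characteristic $p>0$ and let $(\mathfrak{g},[p])$ be a finite-dimensional restricted Lie algebra over $k$ such that $V(\mathfrak{g})=\{x\in\mathfrak{g} : x^{[p]}=0\}$ is a subspace of $\mathfrak{g}$. Let $j\in\{1,\ldots,p-1\}$ and let $M$ be a finite-dimensional $U_0(\mathfrak{g})$-module of constant $j$-rank $d_j$. Then the image of the morphism \[ \mathrm{im}^j_M:\mathbb{P}(V(\mathfrak{g}))\to\mathrm{Gr}_{d_j}(M),\qquad [x]\mapsto\mathrm{im}\,x_M^j,\] has dimension $\dim \mathrm{im}^j_M(\mathbb{P}(V(\mathfrak{g})))\in\{0,\dim V(\mathfrak{g})-1\}$.
   Context: $U_0(\mathfrak{g})=U(\mathfrak{g})/(\{x^p-x^{[p]} : x\in\mathfrak{g}\})$ is the restricted enveloping algebra. For $x\in\mathfrak{g}$, $x_M:M\to M$ is the operator $m\mapsto x.m$. $M$ has constant $j$-rank $d_j$ if $\mathrm{rk}(x_M^j)=d_j$ for all $x\in V(\mathfrak{g})\setminus\{0\}$. $\mathrm{Gr}_d(M)$ is the Grassmannian of $d$-dimensional subspaces of $M$ ($\mathrm{Gr}_0(M)$ is a point). If $M$ has constant $j$-rank, the displayed map is a morphism of varieties. As usual, the empty variety has dimension $-1$. *)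

(* Defs.v *)
From HB Require Import structures.
From mathcomp Require Import all_boot all_order all_algebra.
From mathcomp Require Import boolp.
From mathcomp Require Import classical_sets.
From mathcomp Require mpoly monalg.

Set Implicit Arguments.
Unset Strict Implicit.
Unset Printing Implicit Defensive.

Import GRing.Theory.

Local Open Scope classical_set_scope.
Local Open Scope ring_scope.
Local Open Scope quotient_scope.

Section RestrictedLieAlgebra.
Variables (k : fieldType) (g : vectType k).

(* jacobson_coef br x y n i is the coefficient of T^i in
   (ad (T x + y))^n (x), computed in g[T]. *)
Fixpoint jacobson_coef (br : g -> g -> g) (x y : g) (n i : nat) : g :=
  match n, i with
  | 0, 0 => x
  | 0, _.+1 => 0
  | n'.+1, 0 => br y (jacobson_coef br x y n' 0)
  | n'.+1, i'.+1 => br x (jacobson_coef br x y n' i')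
                    + br y (jacobson_coef br x y n' i'.+1)
  end.

(* s_i(x, y), determined for 1 <= i <= p - 1 by
   (ad (T x + y))^(p-1) (x) = \sum_i i s_i(x, y) T^(i-1). *)
Definition jacobson_s (p : nat) (br : g -> g -> g) (i : nat) (x y : g) : g :=
  (i%:R)^-1 *: jacobson_coef br x y p.-1 i.-1.

Record restrictedLie (p : nat) := RestrictedLie {
  lie : g -> g -> g;
  pmap : g -> g;
  lie_linearl : forall a x y z, lie (a *: x + y) z = a *: lie x z + lie y z;
  lie_linearr : forall a x y z, lie z (a *: x + y) = a *: lie z x + lie z y;
  liexx : forall x, lie x x = 0;
  lie_jacobi : forall x y z,
    lie x (lie y z) + lie y (lie z x) + lie z (lie x y) = 0;
  lie_pmap : forall x y, lie (pmap x) y = iter p (lie x) y;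
  pmapZ : forall a x, pmap (a *: x) = a ^+ p *: pmap x;
  pmapD : forall x y,
    pmap (x + y) = pmap x + pmap y + \sum_(1 <= i < p) jacobson_s p lie i x y
}.

End RestrictedLieAlgebra.

Section QuotientRing.
Variables (A : pzRingType) (S : A -> Prop).

Inductive ideal_gen : A -> Prop :=
  | IdealGen s of S s : ideal_gen s
  | Ideal0 : ideal_gen 0
  | IdealB x y of ideal_gen x & ideal_gen y : ideal_gen (x - y)
  | IdealMl a x of ideal_gen x : ideal_gen (a * x)
  | IdealMr x a of ideal_gen x : ideal_gen (x * a).

Definition ideal_pred : pred A := fun x => `[< ideal_gen x >].

Fact ideal_zmod_closed : zmod_closed ideal_pred.
Proof.
split=> [|x y /asboolP Ix /asboolP Iy]; apply/asboolP; first exact: Ideal0.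
exact: IdealB.
Qed.

HB.instance Definition _ := GRing.isZmodClosed.Build A ideal_pred
  ideal_zmod_closed.

Definition ideal_zmod : zmodClosed A := GRing.ZmodClosed.clone A ideal_pred _.

(* A / (S), for the two-sided ideal (S); possibly the zero ring. *)
Definition quotring : Type := ring_quotient.Quotient.quot ideal_zmod.

HB.instance Definition _ := GRing.Zmodule.on quotring.

Definition qproj (x : A) : quotring :=
  \pi_(ring_quotient.Quotient.quot ideal_zmod) x.

Lemma qprojP (x y : A) : qproj x = qproj y <-> ideal_gen (x - y).
Proof.
split=> [/eqP|H]; last apply/eqP; rewrite -ring_quotient.Quotient.idealrBE.
  by move/asboolP.
exact/asboolP.
Qed.

Definition qrep (u : quotring) : A := repr u.

Lemma qrepK u : qproj (qrep u) = u.
Proof. exact: reprK. Qed.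

Lemma qprojD : {morph qproj : x y / x + y}.
Proof. by move=> x y; rewrite /qproj raddfD. Qed.

Definition qone : quotring := qproj 1.
Definition qmul (u v : quotring) : quotring := qproj (qrep u * qrep v).

Lemma qprojM x y : qproj (x * y) = qmul (qproj x) (qproj y).
Proof.
apply/qprojP.
have Ix : ideal_gen (x - qrep (qproj x)) by apply/qprojP; rewrite qrepK.
have Iy : ideal_gen (qrep (qproj y) - y) by apply/qprojP; rewrite qrepK.
have -> : x * y - qrep (qproj x) * qrep (qproj y) =
  (x - qrep (qproj x)) * y - qrep (qproj x) * (qrep (qproj y) - y).
  by rewrite mulrBl mulrBr opprB addrA subrK.
by apply: IdealB; [apply: IdealMr | apply: IdealMl].
Qed.

Fact qmulA : associative qmul.
Proof. by move=> u v w; rewrite -(qrepK u) -(qrepK v) -(qrepK w) -!qprojM mulrA. Qed.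
Fact qmul1 : left_id qone qmul.
Proof. by move=> u; rewrite -(qrepK u) -!qprojM mul1r. Qed.
Fact qmulr1 : right_id qone qmul.
Proof. by move=> u; rewrite -(qrepK u) -!qprojM mulr1. Qed.
Fact qmulDl : left_distributive qmul +%R.
Proof.
move=> u v w; rewrite -(qrepK u) -(qrepK v) -(qrepK w).
by rewrite -qprojD -!qprojM mulrDl qprojD.
Qed.
Fact qmulDr : right_distributive qmul +%R.
Proof.
move=> u v w; rewrite -(qrepK u) -(qrepK v) -(qrepK w).
by rewrite -qprojD -!qprojM mulrDr qprojD.
Qed.

HB.instance Definition _ := GRing.Zmodule_isPzRing.Build quotring
  qmulA qmul1 qmulr1 qmulDl qmulDr.

End QuotientRing.

Section RestrictedEnvelopingAlgebra.
Import monalg.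
Variables (k : fieldType) (p : nat) (g : vectType k) (L : restrictedLie g p).

(* The free associative unital k-algebra on the underlying set of g. *)
Definition free_alg := {malg k[{fmonom g}]}.

HB.instance Definition _ := GRing.NzRing.on free_alg.

Definition freeX (x : g) : free_alg := mkmalgU (fmu x) 1.
Definition freeC (c : k) : free_alg := mkmalgU (fmone g) c.

Inductive tensor_rel : free_alg -> Prop :=
  | TensorD x y : tensor_rel (freeX (x + y) - (freeX x + freeX y))
  | TensorZ c x : tensor_rel (freeX (c *: x) - freeC c * freeX x).

Definition tensor_alg := quotring tensor_rel.
HB.instance Definition _ := GRing.PzRing.on tensor_alg.
Definition tensorX (x : g) : tensor_alg := qproj tensor_rel (freeX x).
Definition tensorC (c : k) : tensor_alg := qproj tensor_rel (freeC c).

Inductive env_rel : tensor_alg -> Prop :=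
  | EnvLie x y : env_rel (tensorX x * tensorX y - tensorX y * tensorX x
                          - tensorX (lie L x y)).

Definition env_alg := quotring env_rel.
HB.instance Definition _ := GRing.PzRing.on env_alg.
Definition envX (x : g) : env_alg := qproj env_rel (tensorX x).
Definition envC (c : k) : env_alg := qproj env_rel (tensorC c).

Inductive renv_rel : env_alg -> Prop :=
  | REnvP x : renv_rel (envX x ^+ p - envX (pmap L x)).

(* U_0(g), with its canonical maps from g and from the scalars. *)
Definition renv_alg := quotring renv_rel.
HB.instance Definition _ := GRing.PzRing.on renv_alg.
Definition renvX (x : g) : renv_alg := qproj renv_rel (envX x).
Definition renvC (c : k) : renv_alg := qproj renv_rel (envC c).

Lemma freeCM c f : freeC c * f = f * freeC c.
Proof.
rewrite [f]monalgE mulr_sumr mulr_suml; apply: eq_bigr => m _.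
have E := @fgmulUU (fmonom g) k.
rewrite [LHS]E [RHS]E mulrC; congr (mkmalgU _ _).
by rewrite mul1m mulm1.
Qed.

Lemma renvCM c u : renvC c * u = u * renvC c.
Proof.
rewrite -(qrepK u) -(qrepK (qrep u)) -(qrepK (qrep (qrep u))).
rewrite -[LHS]qprojM -[RHS]qprojM; congr (qproj _ _).
rewrite -[LHS]qprojM -[RHS]qprojM; congr (qproj _ _).
by rewrite -[LHS]qprojM -[RHS]qprojM freeCM.
Qed.

(* A U_0(g)-module structure on M whose underlying k-vector space (along the
   structure map k -> U_0(g)) is the given one. *)
Record renv_module (M : vectType k) := RenvModule {
  uact : renv_alg -> M -> M;
  uactDl : forall u v m, uact (u + v) m = uact u m + uact v m;
  uactDr : forall u m n, uact u (m + n) = uact u m + uact u n;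
  uactA : forall u v m, uact (u * v) m = uact u (uact v m);
  uact1 : forall m, uact 1 m = m;
  uactC : forall c m, uact (renvC c) m = c *: m
}.

Lemma renvXZ c x : renvX (c *: x) = renvC c * renvX x.
Proof.
rewrite -[RHS]qprojM; congr (qproj _ _); rewrite -[RHS]qprojM.
congr (qproj _ _); rewrite -[RHS]qprojM; apply/qprojP.
exact/IdealGen/TensorZ.
Qed.

Section Operators.
Variables (M : vectType k) (MM : renv_module M).

Fact xM_linear (x : g) : linear (uact MM (renvX x)).
Proof. by move=> c m n; rewrite uactDr -!(uactC MM) -!uactA renvCM. Qed.

HB.instance Definition _ x :=
  GRing.isLinear.Build k M M *:%R (uact MM (renvX x)) (xM_linear x).

Definition xM (x : g) : 'End(M) := linfun (uact MM (renvX x)).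

Lemma xME x m : xM x m = uact MM (renvX x) m.
Proof. exact: lfunE. Qed.

Definition xMpow (j : nat) (x : g) : 'End(M) :=
  iter j (fun f => (xM x \o f)%VF) \1%VF.

Lemma xMpowE j x m : xMpow j x m = iter j (xM x) m.
Proof. by elim: j => [|j IH] /=; rewrite ?id_lfunE ?comp_lfunE ?IH. Qed.

Lemma xMpowZ j c x : xMpow j (c *: x) = c ^+ j *: xMpow j x.
Proof.
apply/lfunP => m; rewrite scale_lfunE !xMpowE.
elim: j => [|j IH]; first by rewrite scale1r.
by rewrite !iterS IH !xME renvXZ uactA uactC linearZ scalerA exprS.
Qed.

End Operators.

End RestrictedEnvelopingAlgebra.

(* Krull dimension of a subset Y of the space T whose closed subsets are
   given by the predicate cl; Y carries the subspace topology. *)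
Section KrullDimension.
Variables (T : Type) (cl : set T -> Prop).

Definition closed_in (Y Z : set T) : Prop := exists2 C, cl C & Z = Y `&` C.

Definition irreducible_set (Z : set T) : Prop :=
  Z !=set0 /\
  forall C D, cl C -> cl D -> Z `<=` C `|` D -> Z `<=` C \/ Z `<=` D.

Definition irreducible_chain (Y : set T) (m : nat) (Z : nat -> set T) : Prop :=
  (forall i, (i <= m)%N -> closed_in Y (Z i) /\ irreducible_set (Z i)) /\
  (forall i, (i < m)%N -> Z i `<` Z i.+1).

(* The supremum of the lengths of the chains is n, where the supremum of the
   empty set is -1. *)
Definition has_krull_dim (Y : set T) (n : int) : Prop :=
  -1 <= n /\
  forall m : nat, (exists Z, irreducible_chain Y m Z) <-> (m%:Z <= n).

End KrullDimension.

Section Grassmannian.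
Import mpoly.
Variables (k : fieldType) (M : vectType k) (d : nat).

Definition grassmannian := {W : {vspace M} | \dim W == d}.

Local Notation N := (#|{ffun 'I_d -> 'I_(\dim {:M})}|).

(* Pluecker coordinates of W, indexed by all d-tuples of coordinates of M (the
   ones that are not strictly increasing are redundant: zero or equal to
   another one up to sign). They depend on the basis of W only through a
   common nonzero factor. *)
Definition pluecker (W : {vspace M}) (I : {ffun 'I_d -> 'I_(\dim {:M})}) : k :=
  \det (\matrix_(a < d, b < d) coord (vbasis {:M}) (I b) (vbasis W)`_a).

Definition pluecker_pt (W : {vspace M}) (i : 'I_N) : k :=
  pluecker W (enum_val i).

(* Zariski closed subsets: those cut out by homogeneous polynomials in the
   Pluecker coordinates. *)
Definition gr_closed (Z : set grassmannian) : Prop :=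
  exists2 E : set {mpoly k[N]},
    (forall f, E f -> exists e, f \is e.-homog) &
    Z = [set W | forall f, E f -> meval (pluecker_pt (val W)) f = 0].

End Grassmannian.

Section ImageMap.
Variables (k : fieldType) (p : nat) (g : vectType k) (L : restrictedLie g p).

Definition is_nullcone (V : {vspace g}) : Prop :=
  forall x, x \in V <-> pmap L x = 0.

Definition proj_space (V : {vspace g}) :=
  {l : {vspace g} | (l <= V)%VS && (\dim l == 1%N)}.

Variables (M : vectType k) (MM : renv_module L M).

Definition constant_jrank (j d : nat) : Prop :=
  forall x, pmap L x = 0 -> x != 0 -> \dim (limg (xMpow MM j x)) = d.

Variables (V : {vspace g}) (hV : is_nullcone V).
Variables (j d : nat) (hd : constant_jrank j d).

Fact im_map_subproof (l : proj_space V) :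
  \dim (limg (xMpow MM j (vpick (val l)))) == d.
Proof.
case: l => l /= /andP[lV /eqP dl]; apply/eqP/hd.
  exact/hV/(subvP lV)/memv_pick.
by rewrite vpick0 -dimv_eq0 dl.
Qed.

(* The line l is [x] for x := vpick l; see im_mapE. *)
Definition im_map (l : proj_space V) : grassmannian M d :=
  exist _ (limg (xMpow MM j (vpick (val l)))) (im_map_subproof l).

Lemma im_mapE (l : proj_space V) (x : g) :
  x != 0 -> val l = <[x]>%VS -> val (im_map l) = limg (xMpow MM j x).
Proof.
move=> x0 lx /=; have : vpick (val l) \in <[x]>%VS by rewrite -lx memv_pick.
case/vlineP => c Ec.
have c0 : c != 0.
  apply/eqP => cz.
  by move: Ec; rewrite cz scale0r => /eqP; rewrite vpick0 lx -dimv_eq0 dim_vline x0.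
rewrite Ec xMpowZ; apply/vspaceP => w; apply/memv_imgP/memv_imgP => -[m _ ->].
  by exists (c ^+ j *: m); rewrite ?memvf // scale_lfunE linearZ.
exists (c ^- j *: m); rewrite ?memvf // scale_lfunE linearZ /= scalerA.
by rewrite mulfV ?scale1r // expf_neq0.
Qed.

End ImageMap.

(* Main.v *)
(* In coordinates on V := V(g), the d x d minors F_(I,J) of the matrix of x_M^j
   are forms, and F_(I,J)(x) = c_J(x) P_I(x) where P(x) is the vector of
   Pluecker coordinates of im x_M^j. By constant rank F is a rank-one matrix
   that vanishes nowhere on V \ {0}, so unique factorization in k[V] gives
   F_(I,J) = h_I u_J with forms h_I of a common degree e, without common zero
   off the origin, and h(x) is proportional to P(x).
   If e = 0 the image is a point. If e > 0, the projective Nullstellensatz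
   makes k[V] integral over k[h]. The lowest nonzero coefficient of an integral
   equation of a coordinate vanishes on the hyperplane where this coordinate is
   zero, so the images of the members of a full flag of subspaces of V have
   distinct closures: this is a chain of length dim V - 1. Conversely a chain of
   length q yields q + 1 forms that are algebraically independent on its largest
   member, hence q + 1 <= dim V because any dim V + 1 polynomials on V are
   algebraically dependent. *)
From HB Require Import structures.
Require Import Defs.
From mathcomp Require Import all_boot all_order all_algebra.
From mathcomp Require Import boolp classical_sets.
From mathcomp Require Import mpoly ring zify.

Set Implicit Arguments.
Unset Strict Implicit.
Unset Printing Implicit Defensive.

Import GRing.Theory.

Local Open Scope classical_set_scope.
Local Open Scope ring_scope.

(** * Polynomials as univariate polynomials in the last variable *)

Section Muni.
Variables (R : idomainType) (n : nat).
Implicit Types (p q : {mpoly R[n.+1]}) (m : 'X_{1..n}).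

Local Notation last := (@ord_max n).
Local Notation widen := (widen_ord (leqnSn n)).

Definition mnmcat m (i : nat) : 'X_{1..n.+1} :=
  (mnmwiden m + U_(last) *+ i)%MM.

Lemma mnmcat_last m i : mnmcat m i last = i.
Proof.
by rewrite mnmDE mnmwiden_ordmax mulmnE mnm1E eqxx mul1n.
Qed.

Lemma mnmcat_widen m i j : mnmcat m i (widen j) = m j.
Proof.
rewrite mnmDE mnmwiden_widen mulmnE mnm1E.
by rewrite -val_eqE /= gtn_eqF ?ltn_ord // addn0.
Qed.

Lemma ord_widenP (P : 'I_n.+1 -> Prop) :
  P last -> (forall j, P (widen j)) -> forall i, P i.
Proof.
move=> Pl Pw i; case: (ltnP i n) => hi.
  by have -> : i = widen (Ordinal hi) by apply: val_inj.
by have -> : i = last by apply/val_inj/eqP; rewrite eqn_leq hi -ltnS ltn_ord.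
Qed.

Lemma mnmcat_inj m m' i i' : mnmcat m i = mnmcat m' i' -> m = m' /\ i = i'.
Proof.
move=> E; split; last by rewrite -(mnmcat_last m i) E mnmcat_last.
by apply/mnmP => j; rewrite -(mnmcat_widen m i) E mnmcat_widen.
Qed.

Lemma mnmcatK (m : 'X_{1..n.+1}) :
  mnmcat [multinom m (widen i) | i < n] (m last) = m.
Proof.
apply/mnmP; apply: ord_widenP => [|j]; first by rewrite mnmcat_last.
by rewrite mnmcat_widen mnmE.
Qed.

(** In a form, every monomial other than the pure power of the last variable contains an earlier
    variable; hence it vanishes at (0, ..., 0, 1). *)
Lemma mnm_widen_neq0 (m : 'X_{1..n.+1}) :
  m != (U_(last) *+ mdeg m)%MM -> exists j, m (widen j) != 0%N.
Proof.
move=> ne; apply: contrapT => /forallNP H; case/eqP: ne.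
have m0 j : m (widen j) = 0%N by apply/eqP/negPn/negP/H.
rewrite mdegE big_ord_recr /= big1 ?add0n => [|i _]; last exact: m0.
apply/mnmP; apply: ord_widenP => [|j]; rewrite mulmnE mnm1E.
  by rewrite eqxx mul1n.
by rewrite m0 -val_eqE /= gtn_eqF.
Qed.

Lemma mdeg_mnmwiden m : mdeg (mnmwiden m) = mdeg m.
Proof.
rewrite !mdegE big_ord_recr /= mnmwiden_ordmax addn0.
by apply: eq_bigr => i _; rewrite mnmwiden_widen.
Qed.

Lemma mdeg_mnmcat m i : mdeg (mnmcat m i) = (mdeg m + i)%N.
Proof. by rewrite mdegD mdeg_mnmwiden mdegMn mdeg1 mul1n. Qed.

Lemma muniXm (m : 'X_{1..n.+1}) :
  muni ('X_[m] : {mpoly R[n.+1]}) =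
  'X_[[multinom m (widen i) | i < n]] *: 'X^(m last).
Proof. by rewrite muniE msuppX big_seq1 mcoeffX eqxx scale1r. Qed.

Lemma coef_muni p i m : ((muni p)`_i)@_m = p@_(mnmcat m i).
Proof.
rewrite [p in LHS]mpolyE raddf_sum coef_sum raddf_sum /=.
rewrite [p in RHS]mpolyE raddf_sum /=.
apply: eq_bigr => m' _; rewrite muniZ muniXm.
rewrite mcoeffZ mcoeffX -mul_polyC coefCM coefZ coefXn.
rewrite mul_mpolyC mcoeffZ; congr (_ * _).
case: eqP => [iE|ne]; rewrite ?mulr1 ?mulr0 ?mcoeffX ?mcoeff0.
  congr ((nat_of_bool _)%:R); rewrite iE -{2}(mnmcatK m').
  by apply/eqP/eqP => [->//|/mnmcat_inj[]].
by case: eqP => // E; case: ne; rewrite E mnmcat_last.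
Qed.

(** The inverse of [muni]. As a ring isomorphism the pair transports factoriality and univariate
    division to polynomials in several variables. *)
Definition mjoin (P : {poly {mpoly R[n]}}) : {mpoly R[n.+1]} :=
  (map_poly (@mwiden n R) P).['X_last].

Lemma mjoin_is_zmod_morphism : zmod_morphism mjoin.
Proof. by move=> P Q; rewrite /mjoin rmorphB hornerD hornerN. Qed.
Lemma mjoin_is_monoid_morphism : monoid_morphism mjoin.
Proof.
by split=> [|P Q]; rewrite /mjoin ?rmorph1 ?hornerC // rmorphM hornerM.
Qed.
HB.instance Definition _ := GRing.isZmodMorphism.Build _ _ mjoin
  mjoin_is_zmod_morphism.
HB.instance Definition _ := GRing.isMonoidMorphism.Build _ _ mjoin
  mjoin_is_monoid_morphism.

Lemma mjoinD : {morph mjoin : P Q / P + Q}.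
Proof. exact: rmorphD. Qed.

Lemma mjoinM : {morph mjoin : P Q / P * Q}.
Proof. exact: rmorphM. Qed.

Lemma mjoinC c : mjoin c%:P = mwiden c.
Proof. by rewrite /mjoin map_polyC hornerC. Qed.

Lemma mjoinX : mjoin 'X = 'X_last.
Proof. by rewrite /mjoin map_polyX hornerX. Qed.

Lemma muniK : cancel (@muni n R) mjoin.
Proof.
move=> p; rewrite [p in LHS]mpolyE (raddf_sum (@muni n R)) (raddf_sum mjoin).
rewrite [RHS]mpolyE.
apply: eq_bigr => m _; rewrite /= muniZ muniXm.
rewrite -!mul_polyC !rmorphM rmorphXn /= !mjoinC mjoinX mwidenC mwidenX.
by rewrite mpolyXn -mpolyXD mul_mpolyC -/(mnmcat _ _) mnmcatK.
Qed.

Lemma muni_mwiden c : muni (mwiden c : {mpoly R[n.+1]}) = c%:P.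
Proof.
apply/polyP => i; apply/mpolyP => m; rewrite coef_muni coefC.
case: i => [|i] /=.
  rewrite -(mwiden_mnmwiden c); congr (_ @_ _).
  by apply/mnmP; apply: ord_widenP => [|j];
    rewrite ?mnmcat_last ?mnmcat_widen ?mnmwiden_ordmax ?mnmwiden_widen.
rewrite mcoeff0 (mwidenE (leqnn _)) raddf_sum /= big1 // => m' _.
rewrite mcoeffZ mcoeffX; case: eqP => [E|]; rewrite ?mulr0 //.
by have := mnmwiden_ordmax m'; rewrite E mnmcat_last.
Qed.

Lemma muniX : muni ('X_last : {mpoly R[n.+1]}) = 'X.
Proof.
have -> : 'X_last = 'X_[mnmcat 0 1] :> {mpoly R[n.+1]}.
  congr 'X_[_]; apply/mnmP; apply: ord_widenP => [|j].
    by rewrite mnmcat_last mnm1E eqxx.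
  by rewrite mnmcat_widen mnm0E mnm1E -val_eqE /= gtn_eqF.
rewrite muniXm mnmcat_last expr1 -[RHS]scale1r -mpolyX0; congr ('X_[_] *: _).
by apply/mnmP => j; rewrite mnmE mnmcat_widen.
Qed.

Lemma mjoinK : cancel mjoin (@muni n R).
Proof.
move=> P; rewrite -[P in LHS]coefK poly_def (raddf_sum mjoin).
rewrite (raddf_sum (@muni n R)) /=.
rewrite -[RHS]coefK poly_def; apply: eq_bigr => i _.
by rewrite -!mul_polyC !rmorphM !rmorphXn /= mjoinC mjoinX muni_mwiden muniX.
Qed.

Definition vjoin (v : 'I_n -> R) (b : R) (i : 'I_n.+1) : R :=
  if insub (val i) is Some j then v j else b.

Lemma vjoin_last v b : vjoin v b last = b.
Proof. by rewrite /vjoin insubN //= ltnn. Qed.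

Lemma vjoin_widen v b j : vjoin v b (widen j) = v j.
Proof.
rewrite /vjoin; case: insubP => [u _ /= /val_inj -> //|].
by rewrite /= ltn_ord.
Qed.

Lemma meval_muni p v b :
  p.@[vjoin v b] = (map_poly (meval v) (muni p)).[b].
Proof.
rewrite [p in LHS]mpolyE [p in RHS]mpolyE (raddf_sum (meval _)).
rewrite (raddf_sum (@muni n R)) /= (rmorph_sum (map_poly _)) horner_sum /=.
apply: eq_bigr => m _; rewrite mevalZ muniZ muniXm.
rewrite -!mul_polyC !rmorphM /= !map_polyC /= !map_polyXn !hornerCM hornerXn.
rewrite mevalC; congr (_ * _); rewrite !mevalX big_ord_recr /= vjoin_last.
congr (_ * _); apply: eq_bigr => i _.
by rewrite vjoin_widen mnmE.
Qed.

Lemma meval_vjoin v (w : 'I_n.+1 -> R) p :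
  (forall j, v j = w (widen j)) -> p.@[w] = p.@[vjoin v (w last)].
Proof.
move=> vw; apply: meval_eq; apply: ord_widenP => [|j].
  by rewrite vjoin_last.
by rewrite vjoin_widen vw.
Qed.

End Muni.

(** * Points at which a nonzero polynomial does not vanish *)

Section NonVanishing.
Variable k : closedFieldType.

(** Induction on the variables: first a point where the leading coefficient in the last variable
    survives, then a non-root of the resulting univariate polynomial. *)
Lemma mpoly_neq0_point n (p : {mpoly k[n]}) : p != 0 -> exists v, p.@[v] != 0.
Proof.
elim: n p => [|n IH] p p0.
  exists (fun=> 0); rewrite (nvar0_mpolyC p) mevalC.
  by apply: contra_neq p0 => E; rewrite (nvar0_mpolyC p) E mpolyC0.
have : muni p != 0.
  by apply: contra_neq p0 => E; rewrite -(muniK p) E rmorph0.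
rewrite -lead_coef_eq0 => /IH[v hv].
have : map_poly (meval v) (muni p) != 0.
  apply: contra_neq hv => E; rewrite lead_coefE.
  by have := congr1 (fun q : {poly k} => q`_(size (muni p)).-1) E;
    rewrite coef_map coef0.
case/closed_nonrootP => b hb; exists (vjoin v b).
by rewrite meval_muni.
Qed.

(** Multiplying by ['X_ord0] forces the extra condition. A vector with nonzero coordinate 0 stays
    nonzero under every truncation of the flag used for the lower bound. *)
Lemma mpoly_neq0_nonzero_point n (p : {mpoly k[n.+1]}) :
  p != 0 -> exists2 v, v ord0 != 0 & p.@[v] != 0.
Proof.
move=> p0; have : p * 'X_ord0 != 0.
  rewrite mulf_neq0 //; apply/eqP => /(congr1 (mcoeff U_(ord0))).
  by rewrite mcoeffXU eqxx mcoeff0 => /eqP; rewrite oner_eq0.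
case/mpoly_neq0_point => v; rewrite mevalM mevalXU mulf_eq0 negb_or.
by case/andP; exists v.
Qed.

End NonVanishing.

(** * Factorial domains and rank-one matrices *)

Section Factorial.
Variable R : idomainType.
Implicit Types (a b c x y : R) (s q : {poly R}).

Definition divides x y := exists z, y = x * z.

Definition prime_elt x :=
  [/\ x != 0, x \isn't a GRing.unit &
   forall a b, divides x (a * b) -> divides x a \/ divides x b].

Definition irreducible_elt x :=
  [/\ x != 0, x \isn't a GRing.unit &
   forall a b, x = a * b -> a \is a GRing.unit \/ b \is a GRing.unit].

(* The measure replaces the usual chain condition on principal ideals. *)
Definition factorial_domain :=
  (exists mu : R -> nat, forall x y, x != 0 -> y != 0 ->
     (mu x <= mu (x * y)%R)%N /\
     (y \isn't a GRing.unit -> (mu x < mu (x * y)%R)%N)) /\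
  (forall x, irreducible_elt x -> prime_elt x).

(** Descent on [mu]: a reducible element has a nonunit factor of strictly smaller measure, and
    irreducible elements are prime. *)
Lemma prime_divisor x : factorial_domain -> x != 0 -> x \isn't a GRing.unit ->
  exists2 a, prime_elt a & divides a x.
Proof.
case=> -[mu hmu] irrP; move: {2}(mu x).+1 (ltnSn (mu x)) => N.
elim: N x => // N IH x; rewrite ltnS => mux x0 xU.
case: (pselect (irreducible_elt x)) => [/irrP px|].
  by exists x => //; exists 1; rewrite mulr1.
move=> nirr; have [a [b [xab aU bU]]] : exists a b,
    [/\ x = a * b, a \isn't a GRing.unit & b \isn't a GRing.unit].
  apply: contrapT => nab; apply: nirr; split=> // a b xab.
  apply: contrapT => /not_orP[/negP aU /negP bU]; apply: nab.
  by exists a, b.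
have [a0 b0] : a != 0 /\ b != 0.
  by split; apply: contra_neq x0 => E; rewrite xab E (mul0r, mulr0).
have [|c pc [z az]] := IH a _ a0 aU.
  by apply: leq_trans mux; rewrite xab; have [_] := hmu a b a0 b0; apply.
by exists c => //; exists (z * b); rewrite xab az mulrA.
Qed.

Lemma poly_scaleI c s q : c != 0 -> c *: s = c *: q -> s = q.
Proof. by move=> c0; rewrite -!mul_polyC; apply: mulfI; rewrite polyC_eq0. Qed.

Definition cdivides c s := exists t, s = c *: t.

(** Gauss's lemma for one prime. Since [x] divides the product of the leading coefficients, it
    divides one of them; removing that leading term keeps the product divisible and lowers the total
    size. *)
Lemma prime_elt_poly x s q : prime_elt x ->
  cdivides x (s * q) -> cdivides x s \/ cdivides x q.
Proof.
case=> x0 xU xP; move: {2}(size s + size q).+1 (ltnSn (size s + size q)) => N.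
elim: N s q => // N IH s q; rewrite ltnS => le [t st].
have [-> | s0] := eqVneq s 0; first by left; exists 0; rewrite scaler0.
have [-> | q0] := eqVneq q 0; first by right; exists 0; rewrite scaler0.
have dropl (u v w : {poly R}) z : u != 0 -> u * v = x *: w ->
    lead_coef u = x * z -> let u' := u - x *: (z *: 'X^((size u).-1)) in
    (size u' < size u)%N /\ exists w', u' * v = x *: w'.
  move=> u0 uv luz u'; split; last first.
    exists (w - z *: 'X^((size u).-1) * v).
    by rewrite mulrBl uv -scalerAl scalerBr.
  rewrite -(ltn_predK (_ : 0 < size u)%N) ?size_poly_gt0 // ltnS.
  apply/leq_sizeP => i; rewrite leq_eqVlt => /predU1P[<-|lti].
    by rewrite coefB !coefZ coefXn eqxx mulr1 -luz lead_coefE subrr.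
  rewrite coefB !coefZ coefXn gtn_eqF // !mulr0 subr0 nth_default //.
  by rewrite -(ltn_predK (_ : 0 < size u)%N) ?size_poly_gt0.
have : divides x (lead_coef s * lead_coef q).
  by exists t`_(size (s * q)).-1; rewrite -lead_coefM lead_coefE st coefZ.
case/xP => -[z lz].
  have [ltu [w' uw']] := dropl s q t z s0 st lz.
  have [|[t' E]|] := IH _ q _ (ex_intro _ w' uw'); last by right.
    by apply: leq_trans le; rewrite ltn_add2r.
  left; exists (t' + z *: 'X^((size s).-1)); rewrite scalerDr -E.
  by rewrite subrK.
have [|ltu [w' uw']] := dropl q s t z q0 _ lz; first by rewrite mulrC.
rewrite mulrC in uw'.
have [||[t' E]] := IH s _ _ (ex_intro _ w' uw').
- by apply: leq_trans le; rewrite ltn_add2l.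
- by left.
right; exists (t' + z *: 'X^((size q).-1)); rewrite scalerDr -E.
by rewrite subrK.
Qed.

(** Prime factors of [c] are peeled off one at a time; by [prime_elt_poly] each divides [s] or [q]
    and is collected in [c1] or [c2]. This splitting stands in for the notion of content. *)
Lemma Gauss_split c s q : factorial_domain -> c != 0 -> cdivides c (s * q) ->
  exists c1 c2, [/\ c = c1 * c2, cdivides c1 s & cdivides c2 q].
Proof.
move=> hR; have [[mu hmu] irrP] := hR.
move: {2}(mu c).+1 (ltnSn (mu c)) => N.
elim: N c s q => // N IH c s q; rewrite ltnS => le c0 [t st].
case: (boolP (c \is a GRing.unit)) => cU.
  exists c, 1; split; first by rewrite mulr1.
    by exists (c^-1 *: s); rewrite scalerA divrr // scale1r.
  by exists q; rewrite scale1r.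
have [x px [c' cE]] := prime_divisor hR c0 cU.
have [x0 xU _] := px.
have c'0 : c' != 0 by apply: contra_neq c0 => E; rewrite cE E mulr0.
have lec : (mu c' < N)%N.
  apply: leq_trans le; rewrite cE mulrC.
  by have [_] := hmu c' x c'0 x0; apply.
have : cdivides x (s * q) by exists (c' *: t); rewrite st cE scalerA.
case/(prime_elt_poly px) => -[t' E].
  have [|c1 [c2 [cE' [s1 sE] qE]]] := IH c' t' q lec c'0.
    exists t; apply: (poly_scaleI x0).
    by rewrite scalerA -cE -st E scalerAl.
  exists (x * c1), c2; split=> //; first by rewrite cE cE' mulrA.
  by exists s1; rewrite E sE scalerA.
have [|c1 [c2 [cE' sE [q1 qE]]]] := IH c' s t' lec c'0.
  exists t; apply: (poly_scaleI x0).
  by rewrite scalerA -cE -st E scalerAr.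
exists c1, (x * c2); split=> //; first by rewrite cE cE' mulrCA.
by exists q1; rewrite E qE scalerA.
Qed.

End Factorial.

Section FactorialPoly.
Variable R : idomainType.
Hypothesis hR : factorial_domain R.
Implicit Types (f s q : {poly R}).
Import Pdiv.Idomain.

(** The condition on constant divisors says that [f] is primitive. When [c] is split between [f] and
    [q], the part that divides [f] is then a unit, so [c] cancels against [q]. *)
Lemma dvd_of_scaled_dvd f (c : R) s q :
  (forall a : R, cdivides a f -> a \is a GRing.unit) ->
  c != 0 -> c *: s = f * q -> divides f s.
Proof.
move=> prim c0 E.
have [|c1 [c2 [cE [f' fE] [q' qE]]]] := @Gauss_split _ c f q hR c0.
  by exists s.
have c1U : c1 \is a GRing.unit by apply: prim; exists f'.
have c20 : c2 != 0 by apply: contra_neq c0 => c20; rewrite cE c20 mulr0.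
exists (c1^-1 *: q'); rewrite -scalerAr.
apply: (@poly_scaleI _ c1).
  by apply: contra_neq c0 => c10; rewrite cE c10 mul0r.
rewrite scalerA divrr // scale1r; apply: (poly_scaleI c20).
by rewrite scalerA mulrC -cE E qE scalerAr.
Qed.

(** A constant [f] inherits primality from [R]. Otherwise [f] is primitive, and up to scalars its
    greatest common divisor with [x] is [f] or 1: either [f] divides [x], or a Bezout relation
    multiplied by [y] shows that it divides [y]. *)
Lemma irreducible_poly_prime f : irreducible_elt f -> prime_elt f.
Proof.
case=> f0 fU fI; split=> // x y [z xy].
have [sf|] := leqP (size f) 1.
  have fE := size1_polyC sf; set c := f`_0 in fE.
  have ic : irreducible_elt c.
    have c0 : c != 0 by rewrite -polyC_eq0 -fE.
    split=> //; first by apply: contra fU; rewrite fE poly_unitE size_polyC c0 coefC.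
    move=> a b cab; have [||] := fI a%:P b%:P; first by rewrite -polyCM -cab.
      by rewrite poly_unitE coefC => /andP[_]; left.
    by rewrite poly_unitE coefC => /andP[_]; right.
  have := prime_elt_poly (hR.2 _ ic) (ex_intro _ z _).
  rewrite -mul_polyC -fE => /(_ x y xy) [] [t tE]; [left|right];
    by exists t; rewrite tE -mul_polyC -fE.
move=> sf.
have prim a : cdivides a f -> a \is a GRing.unit.
  case=> f' fE; have a0 : a != 0 by apply: contra_neq f0 => a0; rewrite fE a0 scale0r.
  have [||] := fI a%:P f'; first by rewrite mul_polyC.
    by rewrite poly_unitE coefC => /andP[_].
  by rewrite poly_unitE => /andP[/eqP s1]; move: sf; rewrite fE size_scale // s1.
have : gcdp f x %| f by exact: dvdp_gcdl.
case/dvdpP => -[c q] /= c0 E.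
(* Pseudo-division factors only the multiple [c *: f]. Distributing [c] over the two factors gives a
   genuine factorization of [f], to which irreducibility applies. *)
have [|c1 [c2 [cE [q' qE] [d' dE]]]] := @Gauss_split _ c q (gcdp f x) hR c0.
  by exists f.
have c20 : c2 != 0 by apply: contra_neq c0 => c20; rewrite cE c20 mulr0.
have fE : f = q' * d'.
  by apply: (poly_scaleI c0); rewrite E qE dE cE -scalerAl -scalerAr scalerA.
have [q'U|d'U] := fI _ _ fE.
  left; have : gcdp f x %| x by exact: dvdp_gcdr.
  case/dvdpP => -[e r] /= e0 Ex.
  apply: (@dvd_of_scaled_dvd f e x (r * (c2 *: q'^-1)) prim e0).
  rewrite Ex dE fE -!scalerAr; congr (_ *: _).
  by rewrite mulrCA [q' * d']mulrC mulrK.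
right; have : coprimep f x.
  rewrite coprimep_def dE size_scale //.
  by move: d'U; rewrite poly_unitE => /andP[].
case/Bezout_coprimepP => -[u v] /= /eqpP[[a b] /= /andP[a0 b0] ab].
apply: (@dvd_of_scaled_dvd f b y (a *: (u * y + v * z)) prim b0).
have -> : b *: y = (b *: 1) * y by rewrite -scalerAl mul1r.
rewrite -ab -scalerAr -scalerAl; congr (_ *: _).
by rewrite mulrDl -[v * x * y]mulrA xy; ring.
Qed.

Lemma factorial_poly : factorial_domain {poly R}.
Proof.
split; last exact: irreducible_poly_prime.
(* A nonunit factor has a nonunit leading coefficient, which raises [mu], or a positive degree,
   which raises the size. *)
have [[mu hmu] _] := hR; exists (fun f => size f + mu (lead_coef f))%N => x y x0 y0.
have [lx ly] : lead_coef x != 0 /\ lead_coef y != 0 by rewrite !lead_coef_eq0.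
have sx : (size x <= size (x * y)%R)%N.
  by rewrite size_mul //; move: y0; rewrite -size_poly_gt0; lia.
have [le lt] := hmu _ _ lx ly.
rewrite lead_coefM; split=> [|yU]; first by rewrite leq_add.
have [/lt lU|] := boolP (lead_coef y \isn't a GRing.unit).
  by rewrite -addnS leq_add.
rewrite negbK => lU; rewrite -addSn leq_add //.
have sy : (1 < size y)%N.
  rewrite ltnNge; apply: contra yU => sy.
  have s1 : size y = 1%N by apply/eqP; rewrite eqn_leq sy size_poly_gt0.
  by rewrite poly_unitE s1 eqxx /=; move: lU; rewrite lead_coefE s1.
by rewrite size_mul //; move: x0; rewrite -size_poly_gt0; lia.
Qed.

End FactorialPoly.

Lemma factorial_field (k : fieldType) : factorial_domain k.
Proof.
split; first by exists (fun=> 0%N) => x y _ y0; rewrite leqnn unitfE y0.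
by move=> x [x0]; rewrite unitfE x0.
Qed.

Lemma factorial_iso (R S : idomainType) (f : {rmorphism R -> S})
    (g : {rmorphism S -> R}) :
  cancel f g -> cancel g f -> factorial_domain R -> factorial_domain S.
Proof.
move=> fK gK [[mu hmu] irrP].
have gU x : (g x \is a GRing.unit) = (x \is a GRing.unit).
  by apply/idP/idP => [/(rmorph_unit f)|/(rmorph_unit g)]; rewrite ?gK.
have g0 x : (g x == 0) = (x == 0) by rewrite -(inj_eq (can_inj gK)) rmorph0.
split.
  exists (mu \o g) => x y x0 y0 /=; rewrite rmorphM -gU.
  by apply: hmu; rewrite g0.
move=> x [x0 xU xI]; have [|_ _ gP] := irrP (g x).
  split; rewrite ?g0 ?gU // => a b E.
  have [||] := xI (f a) (f b); rewrite -?gU ?fK; try by [left | right].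
  by rewrite -rmorphM -E gK.
split=> // a b [z E]; have [|[t tE]|[t tE]] := gP (g a) (g b).
- by exists (g z); rewrite -!rmorphM E.
- by left; exists (f t); rewrite -(gK a) tE rmorphM gK.
- by right; exists (f t); rewrite -(gK b) tE rmorphM gK.
Qed.

Lemma factorial_mpoly (k : fieldType) n : factorial_domain {mpoly k[n]}.
Proof.
elim: n => [|n IH]; last first.
  exact: (@factorial_iso _ _ (@mjoin k n) (@muni n k) (@mjoinK _ _) (@muniK _ _)
    (factorial_poly IH)).
apply: (@factorial_iso _ _ (@mpolyC 0 k) (@mcoeff 0 k 0%MM) _ _ (factorial_field k)).
  exact: mpolyCK.
exact: mpolyKC.
Qed.

(** * Rank-one matrices of polynomials with a monic entry *)

Section MonicGenerator.
Variable R : idomainType.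
Hypothesis hR : factorial_domain R.
Implicit Types (a f g q : {poly R}).

Section Ideal.
Variables (Q : {poly R} -> Prop) (a : {poly R}).
Hypothesis QB : forall f g, Q f -> Q g -> Q (f - g).
Hypothesis QM : forall f g, Q f -> Q (g * f).
Hypothesis Qsat : forall (c : R) f, c != 0 -> Q (c *: f) -> Q f.
Hypotheses (Qa : Q a) (monic_a : a \is monic).

(** Let [q] have least size in [Q]. Pseudo-division of the monic [a] by [q] leaves no remainder, and
    [Gauss_split] turns it into a = t' q' with q' in [Q] by saturation. The leading coefficient of
    q' divides 1, so q' can be made monic, and division by it is then exact on [Q]. *)
Lemma saturated_ideal_monic_gen :
  exists q, [/\ q \is monic, Q q & forall f, Q f -> exists u, f = u * q].
Proof.
have exQ : exists s, `[< exists2 q, Q q & q != 0 /\ size q = s >].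
  by exists (size a); apply/asboolP; exists a; rewrite ?monic_neq0.
case: (ex_minnP exQ) => s /asboolP[q Qq [q0 <-]] minq {exQ}.
have small f : Q f -> (size f < size q)%N -> f = 0.
  move=> Qf sf; apply/eqP/negPn/negP => f0; move: sf; rewrite ltnNge.
  by rewrite minq //; apply/asboolP; exists f.
have QZ (c : R) f : Q f -> Q (c *: f) by rewrite -mul_polyC; apply: QM.
have := Pdiv.Idomain.divp_eq a q.
set c := _ ^+ _; set t := (a %/ q)%R => E.
have c0 : c != 0 by rewrite expf_neq0 // lead_coef_eq0.
have r0 : (a %% q)%R = 0.
  apply: small; last by rewrite Pdiv.Idomain.ltn_modp.
  have -> : (a %% q)%R = c *: a - t * q by rewrite E addrC addKr.
  by apply: QB; [apply: QZ | apply: QM].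
rewrite r0 addr0 in E.
have [|c1 [c2 [cE [t' tE] [q' qE]]]] := @Gauss_split _ c t q hR c0.
  by exists a.
have c20 : c2 != 0 by apply: contra_neq c0 => c20; rewrite cE c20 mulr0.
have aE : a = t' * q'.
  by apply: (poly_scaleI c0); rewrite E tE qE cE -scalerAl -scalerAr scalerA.
have lq'U : lead_coef q' \is a GRing.unit.
  apply/unitrPr; exists (lead_coef t').
  by rewrite mulrC -lead_coefM -aE; apply/eqP.
have Qq' : Q q' by apply: (Qsat c20); rewrite -qE.
set q1 := (lead_coef q')^-1 *: q'.
have m1 : q1 \is monic.
  by rewrite monicE lead_coefZ mulrC divrr.
have s1 : size q1 = size q.
  by rewrite qE !size_scale // invr_eq0; apply: contraTneq lq'U => ->; rewrite unitr0.
exists q1; split=> // [|f Qf]; first exact: QZ.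
exists (f %/ q1); rewrite [LHS](Pdiv.IdomainMonic.divp_eq m1).
suff -> : (f %% q1)%R = 0 by rewrite addr0.
apply: small; last by rewrite -s1 Pdiv.Idomain.ltn_modp monic_neq0.
have -> : (f %% q1)%R = f - (f %/ q1) * q1.
  by rewrite {2}[f](Pdiv.IdomainMonic.divp_eq m1) addrC addKr.
by apply: QB => //; apply/QM/QZ.
Qed.

End Ideal.

Variables (I J : Type) (F : I -> J -> {poly R}) (i0 : I) (j0 : J).
Hypothesis rk1 : forall i j i' j', F i j * F i' j' = F i j' * F i' j.
Hypothesis monicF : F i0 j0 \is monic.

(** [Q] is the ideal of all f such that a = F(i0,j0) divides every f F(i,j0); the rank-one relation
    puts the row of [i0] into it. With the monic generator q, the factors are u_j = F(i0,j)/q and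
    h_i = q F(i,j0)/a. *)
Lemma rank_one_factor : exists h u, forall i j, F i j = h i * u j.
Proof.
pose a := F i0 j0; have ma : a \is monic by [].
pose Q f := forall i, exists z, f * F i j0 = z * a.
have [||||q [mq Qq gen]] := @saturated_ideal_monic_gen Q a _ _ _ _ ma.
- move=> f g Qf Qg i; have [z zE] := Qf i; have [w wE] := Qg i.
  by exists (z - w); rewrite !mulrBl zE wE.
- move=> f g Qf i; have [z zE] := Qf i.
  by exists (g * z); rewrite -!mulrA zE.
(* Saturation: if r is the remainder modulo the monic [a], then c r is a multiple of [a] of smaller
   size, so r = 0. *)
- move=> c f c0 Qf i; have [z] := Qf i.
  rewrite -scalerAl => zE.
  have E := Pdiv.IdomainMonic.divp_eq ma (f * F i j0).
  exists ((f * F i j0) %/ a); rewrite [LHS]E.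
  suff -> : ((f * F i j0) %% a)%R = 0 by rewrite addr0.
  apply/eqP/negPn/negP; set r := (_ %% _)%R => r0.
  have Er : c *: r = (z - c *: ((f * F i j0) %/ a)) * a.
    by rewrite mulrBl -zE -scalerAl -scalerBr {1}E addrC addKr.
  have w0 : z - c *: ((f * F i j0) %/ a) != 0.
    apply: contra_neq r0 => w0; apply: (poly_scaleI c0).
    by rewrite Er w0 mul0r scaler0.
  have : (size r < size a)%N by rewrite Pdiv.Idomain.ltn_modp monic_neq0.
  rewrite -(size_scale r c0) Er size_Mmonic //.
  by move: w0; rewrite -size_poly_gt0; lia.
- by move=> i; exists (F i j0); rewrite mulrC.
have Qrow j : Q (F i0 j).
  by move=> i; exists (F i j); rewrite [RHS]rk1 mulrC.
have /choice[u uE] : forall j, exists u, F i0 j = u * q.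
  by move=> j; apply/gen/Qrow.
have /choice[h hE] : forall i, exists h, q * F i j0 = h * a by exact: Qq.
exists h, u => i j; apply: (mulIf (monic_neq0 ma)).
by rewrite rk1 -/a uE [RHS]mulrAC -hE; ring.
Qed.

End MonicGenerator.

(** * Homogeneous components *)

Section Homogeneous.
Variables (k : fieldType).

Local Notation comp d := (pihomog mdeg d).

Lemma mcoeff_pihomog n d (p : {mpoly k[n]}) m :
  (comp d p)@_m = if mdeg m == d then p@_m else 0.
Proof.
have hom := @pihomogP n k mdeg d p.
case: (eqVneq (mdeg m) d) => [md|ne]; last exact: (dhomog_nemf_coeff hom ne).
rewrite pihomogE raddf_sum /= [in RHS](mpolyE p) [RHS]raddf_sum /=.
rewrite big_mkcond /=; apply: eq_bigr => m' _.
case: eqP => // ne; rewrite mcoeffZ mcoeffX; case: eqP => [E|]; last by rewrite mulr0.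
by case: ne; rewrite E.
Qed.

Lemma dhomog_coefP n d (p : {mpoly k[n]}) :
  (forall m, p@_m != 0 -> mdeg m = d) <-> p \is d.-homog.
Proof.
split=> [H|/dhomogP H m]; first by apply/dhomogP => m; rewrite mcoeff_msupp => /H.
by rewrite -mcoeff_msupp => /H.
Qed.

Lemma pihomog_big n d (p : {mpoly k[n]}) : (msize p <= d)%N -> comp d p = 0.
Proof.
move=> sp; apply/mpolyP => m; rewrite mcoeff_pihomog mcoeff0.
by case: eqP => // md; apply/memN_msupp_eq0/msize_mdeg_ge; rewrite md.
Qed.

Lemma sum_pihomog n (p : {mpoly k[n]}) : p = \sum_(d < msize p) comp d p.
Proof. exact: pihomog_partitionE. Qed.

Lemma pihomog_neq0 n (p : {mpoly k[n]}) : p != 0 -> exists d, comp d p != 0.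
Proof.
move=> p0; apply: contrapT => /forallNP H; case/eqP: p0.
rewrite (sum_pihomog p) big1 // => d _; apply/eqP/negPn/negP; exact: H.
Qed.

Lemma pihomog_other n d e (p : {mpoly k[n]}) :
  p \is d.-homog -> d != e -> comp e p = 0.
Proof. by move=> hp de; apply: (pihomog_ne0 de hp). Qed.

Lemma pihomogMl n d e (p q : {mpoly k[n]}) :
  p \is d.-homog -> comp (d + e) (p * q) = p * comp e q.
Proof.
move=> hp; rewrite {1}(sum_pihomog q) mulr_sumr raddf_sum /=.
have [se|se] := leqP (msize q) e.
  rewrite (pihomog_big se) mulr0 big1 // => i _.
  apply: (@pihomog_other _ (d + i)); first exact: dhomogM (pihomogP _ _ _).
  by rewrite eqn_add2l neq_ltn (leq_trans (ltn_ord i) se).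
rewrite (bigD1 (Ordinal se)) //= big1 ?addr0 => [|i ne].
  by rewrite pihomog_dE // dhomogM // pihomogP.
apply: (@pihomog_other _ (d + i)); first exact: dhomogM (pihomogP _ _ _).
by rewrite eqn_add2l.
Qed.

Lemma pihomogMl_small n d e (p q : {mpoly k[n]}) :
  p \is d.-homog -> (e < d)%N -> comp e (p * q) = 0.
Proof.
move=> hp ed; rewrite (sum_pihomog q) mulr_sumr raddf_sum /= big1 // => i _.
apply: (@pihomog_other _ (d + i)); first exact: dhomogM (pihomogP _ _ _).
by rewrite gtn_eqF // ltn_addr.
Qed.

Lemma comp_mpolyX_homog n K d (p : K.-tuple {mpoly k[n]}) m :
  (forall i, tnth p i \is d.-homog) -> 'X_[m] \mPo p \is (mdeg m * d).-homog.
Proof.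
move=> hp; rewrite comp_mpolyX mdegE big_distrl /=.
elim/big_ind2: _ => [|x1 x2 y1 y2|i _]; first exact: dhomog1.
  by move=> h1 h2; apply: dhomogM.
by rewrite mulnC; apply: dhomogMn.
Qed.

(** Substituting forms of degree [d] multiplies degrees by [d]; as [d] is positive, distinct
    components stay in distinct degrees. *)
Lemma pihomog_comp n K d t (p : K.-tuple {mpoly k[n]}) (q : {mpoly k[K]}) :
  (0 < d)%N -> (forall i, tnth p i \is d.-homog) ->
  comp (t * d) (q \mPo p) = comp t q \mPo p.
Proof.
move=> d0 hp; rewrite {1}(mpolyE q) [in RHS](mpolyE q) (raddf_sum (comp_mpoly p)).
rewrite !(raddf_sum (pihomog mdeg _)) (raddf_sum (comp_mpoly p)) /=.
apply: eq_bigr => m _; rewrite !linearZ /=; congr (_ *: _).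
have hX := comp_mpolyX_homog m hp.
rewrite pihomogX; case: (eqVneq (mdeg m) t) => [<-|ne].
  by rewrite pihomog_dE.
by rewrite comp_mpoly0 (pihomog_other hX) // eqn_pmul2r.
Qed.

Lemma comp_pihomog_neq0 n K (p : K.-tuple {mpoly k[n]}) (q : {mpoly k[K]}) :
  q \mPo p != 0 -> exists d, comp d q \mPo p != 0.
Proof.
move=> q0; apply: contrapT => /forallNP H; case/eqP: q0.
rewrite (sum_pihomog q) (raddf_sum (comp_mpoly p)) big1 // => d _.
by apply/eqP/negPn/negP/H.
Qed.

Lemma dhomog_comp n K d t (p : K.-tuple {mpoly k[n]}) (q : {mpoly k[K]}) :
  (forall i, tnth p i \is d.-homog) -> q \is t.-homog ->
  q \mPo p \is (t * d).-homog.
Proof.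
move=> hp /dhomogP hq; rewrite comp_mpolyEX big_seq; apply: rpred_sum => m /hq <-.
by apply: dhomogZ; apply: comp_mpolyX_homog.
Qed.

Lemma mevalZ_homog n d (p : {mpoly k[n]}) (v w : 'I_n -> k) c :
  p \is d.-homog -> (forall i, w i = c * v i) -> p.@[w] = c ^+ d * p.@[v].
Proof.
move=> /dhomogP hp wE; rewrite !mevalE mulr_sumr big_seq [RHS]big_seq.
apply: eq_bigr => m /hp <-; rewrite mulrCA; congr (_ * _).
rewrite /= mdegE expr_sum -big_split /=.
by apply: eq_bigr => i _; rewrite wE exprMn.
Qed.

Lemma msize_sub_pihomog n d (p : {mpoly k[n]}) :
  (msize p <= d.+1)%N -> (msize (p - comp d p) <= d)%N.
Proof.
move=> sp; rewrite msizeE; apply/bigmax_leqP_seq => m + _.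
rewrite mcoeff_msupp mcoeffB mcoeff_pihomog; case: (eqVneq (mdeg m) d) => [|ne].
  by rewrite subrr eqxx.
rewrite subr0 -mcoeff_msupp => /msize_mdeg_lt lt.
by rewrite ltn_neqAle ne -ltnS (leq_trans lt).
Qed.

(** The lower parts cannot reach degree a + b. Since the bounds need not be attained, one pair of
    bounds serves all entries of a matrix. *)
Lemma pihomog_topM n a b (p q : {mpoly k[n]}) :
  (msize p <= a.+1)%N -> (msize q <= b.+1)%N ->
  comp (a + b) (p * q) = comp a p * comp b q.
Proof.
move=> sp sq; rewrite -{1}(subrK (comp a p) p) mulrDl raddfD /=.
rewrite (pihomogMl _ _ (pihomogP mdeg a p)) pihomog_big ?add0r //.
have [->|p0] := eqVneq (p - comp a p) 0; first by rewrite mul0r mmeasure0.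
have [->|q0] := eqVneq q 0; first by rewrite mulr0 mmeasure0.
rewrite msizeM //; move: (msize_sub_pihomog sp) sq.
by move: (msize (p - _)) (msize q) => x y; lia.
Qed.

Lemma pihomog_top_neq0 n (p : {mpoly k[n]}) : p != 0 -> comp (msize p).-1 p != 0.
Proof.
move=> p0; have := p0; rewrite -mleadc_eq0; apply: contra_neq => E.
have := congr1 (mcoeff (mlead p)) E.
by rewrite mcoeff_pihomog mcoeff0 -mlead_deg // eqxx.
Qed.

(* Passing to the top components makes the factors of a homogeneous rank-one
   matrix homogeneous. *)
Lemma homog_factor n (I J : finType) (F : I -> J -> {mpoly k[n]}) D i0 j0 h u :
  (forall i j, F i j \is D.-homog) -> F i0 j0 != 0 ->
  (forall i j, F i j = h i * u j) ->
  exists h' u' e, (forall i, h' i \is e.-homog) /\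
    forall i j, F i j = h' i * u' j.
Proof.
move=> hF F0 FE.
have [h0 u0] : h i0 != 0 /\ u j0 != 0.
  by apply/andP; rewrite -negb_or -mulf_eq0 -FE.
have top (T : finType) (f : T -> {mpoly k[n]}) t : f t != 0 ->
    exists a, (forall i, msize (f i) <= a.+1)%N /\ exists i, comp a (f i) != 0.
  move=> ft; pose i1 := [arg max_(i > t) msize (f i)].
  have max i : (msize (f i) <= msize (f i1))%N.
    by rewrite /i1; case: arg_maxnP => // i2 _; apply.
  have f1 : f i1 != 0.
    apply: contraTneq (max t) => ->; rewrite mmeasure0 leqn0.
    by rewrite msize_poly_eq0.
  exists (msize (f i1)).-1; split; last by exists i1; apply: pihomog_top_neq0.
  by move=> i; rewrite -mpolySpred.
have [a [ha [i1 hi1]]] := top _ _ _ h0; have [b [ub [j1 uj1]]] := top _ _ _ u0.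
exists (fun i => comp a (h i)), (fun j => comp b (u j)), a.
split=> [i|i j]; first exact: pihomogP.
have -> : comp a (h i) * comp b (u j) = comp (a + b) (F i j).
  by rewrite FE pihomog_topM.
(* The top components at [i1] and [j1] have a nonzero product, so the entry there has a nonzero
   component in degree a + b. *)
suff <- : D = (a + b)%N by rewrite pihomog_dE.
apply/eqP/negPn/negP => ne; have /eqP := pihomog_other (hF i1 j1) ne.
by rewrite FE pihomog_topM // mulf_eq0 (negPf hi1) (negPf uj1).
Qed.

Lemma homog_last_coef n D (f : {mpoly k[n.+1]}) :
  f \is D.-homog -> f.@[vjoin (fun=> 0) 1] != 0 ->
  f@_(U_(ord_max) *+ D)%MM != 0.
Proof.
move=> /dhomogP hf; apply: contra_neq => f0; rewrite mevalE big_seq big1 // => m mf.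
have [E|ne] := eqVneq m (U_(ord_max) *+ D)%MM; first by rewrite E f0 mul0r.
have [|j mj] := @mnm_widen_neq0 _ m; first by rewrite (hf _ mf).
rewrite [X in _ * X](bigD1 (widen_ord (leqnSn n) j)) //= vjoin_widen.
by rewrite expr0n (negPf mj) mul0r mulr0.
Qed.

(** The coefficient of the i-th power of the last variable is a form of degree D - i. For i = D it
    is a constant, nonzero because [f] does not vanish at (0, ..., 0, 1). *)
Lemma homog_muni n D (f : {mpoly k[n.+1]}) :
  f \is D.-homog -> f.@[vjoin (fun=> 0) 1] != 0 ->
  exists2 c, c != 0 & size (muni f) = D.+1 /\ lead_coef (muni f) = c%:MP.
Proof.
move=> hf /(homog_last_coef hf); set c := f@_ _ => c0; exists c => //.
have cE : (muni f)`_D = c%:MP.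
  apply/mpolyP => m; rewrite coef_muni mcoeffC.
  have [->|m0] := eqVneq m 0%MM.
    by rewrite mulr1 /mnmcat mnmwiden0 add0m.
  rewrite mulr0; apply: (dhomog_nemf_coeff hf).
  by rewrite /= mdeg_mnmcat -{2}[D]add0n eqn_add2r mdeg_eq0.
have s1 : size (muni f) = D.+1.
  apply/eqP; rewrite eqn_leq; apply/andP; split.
    apply/leq_sizeP => i Di; apply/mpolyP => m; rewrite coef_muni mcoeff0.
    apply: (dhomog_nemf_coeff hf); rewrite /= mdeg_mnmcat gtn_eqF //.
    by rewrite ltn_addl.
  rewrite ltnNge; apply/negP => /leq_sizeP/(_ D (leqnn _)) /eqP.
  by rewrite cE mpolyC_eq0 (negPf c0).
by rewrite lead_coefE s1.
Qed.

Lemma muni_scaleM n c (f g f' g' : {mpoly k[n.+1]}) : f * g = f' * g' ->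
  muni (c *: f) * muni (c *: g) = muni (c *: f') * muni (c *: g').
Proof.
move=> E.
have mM (u v : {mpoly k[n.+1]}) :
    muni (c *: u) * muni (c *: v) = muni (c ^+ 2 *: (u * v)).
  by rewrite -muniM expr2 -scalerA -scalerAl -scalerAr.
by apply: etrans (mM f g) _; rewrite E; apply: esym (mM f' g').
Qed.

End Homogeneous.

(** An entry that is nonzero at (0, ..., 0, 1) is, up to a scalar, monic in the last variable. This
    supplies the monic entry for [rank_one_factor]; [homog_factor] then makes one factor
    homogeneous. *)
Lemma homog_rank_one_factor (k : closedFieldType) n (I J : finType)
    (F : I -> J -> {mpoly k[n.+1]}) D :
  (forall i j, F i j \is D.-homog) ->
  (forall v : 'I_n.+1 -> k, (exists i, v i != 0) -> exists i j, (F i j).@[v] != 0) ->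
  (forall i j i' j', F i j * F i' j' = F i j' * F i' j) ->
  exists h u e, (forall i, h i \is e.-homog) /\
    forall i j, F i j = h i * u j.
Proof.
move=> hF F0 rk1.
have [|i0 [j0 f0]] := F0 (vjoin (fun=> 0) 1).
  by exists ord_max; rewrite vjoin_last oner_neq0.
have [c c0 [_ lc]] := homog_muni (hF i0 j0) f0.
have [||h [u hu]] := @rank_one_factor _ (factorial_mpoly k n) _ _
    (fun i j => muni (c^-1 *: F i j)) i0 j0.
- by move=> i j i' j'; apply/muni_scaleM/rk1.
- by rewrite monicE muniZ lead_coefZ lc -mpolyCM mulVf.
apply: (@homog_factor k n.+1 I J F D i0 j0
  (fun i => c *: mjoin (h i)) (fun j => mjoin (u j)) hF).
  by apply: contra_neq f0 => ->; rewrite meval0.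
move=> i j; rewrite -scalerAl -rmorphM /= -hu muniK scalerA divff //.
by rewrite scale1r.
Qed.

(** * Projective Nullstellensatz and integrality *)

(** As the leading coefficients survive, the sizes are preserved and [f] maps one Sylvester matrix
    entrywise to the other; [castdet] only identifies their dimensions. *)
Lemma resultant_map (R S : comNzRingType) (f : {rmorphism R -> S}) (p q : {poly R}) :
  f (lead_coef p) != 0 -> f (lead_coef q) != 0 ->
  f (resultant p q) = resultant (map_poly f p) (map_poly f q).
Proof.
move=> fp fq; rewrite /resultant -det_map_mx.
have sp : size (map_poly f p) = size p by rewrite size_map_poly_id0.
have sq : size (map_poly f q) = size q by rewrite size_map_poly_id0.
have castdet m m' (e : m = m') (A : 'M[S]_m) (B : 'M[S]_m') :
    (forall i j, A i j = B (cast_ord e i) (cast_ord e j)) -> \det A = \det B.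
  case: m' / e B => B AB; congr (\det _); apply/matrixP => i j.
  by rewrite AB !cast_ord_id.
have e : ((size q).-1 + (size p).-1 =
    (size (map_poly f q)).-1 + (size (map_poly f p)).-1)%N by rewrite sp sq.
apply: (castdet _ _ e) => i j; rewrite mxE !Sylvester_mxE /=.
case: splitP => i1 i1E; case: splitP => i2 /= i2E; rewrite ?coef_map rmorphMn.
- by rewrite -i1E i2E.
- by have := ltn_ord i1; rewrite -i1E i2E sq ltnNge leq_addr.
- by have := ltn_ord i2; rewrite -i2E i1E sq ltnNge leq_addr.
by have /eqP := i1E; rewrite i2E sq eqn_add2l => /eqP <-.
Qed.

Lemma unit_fiber_elimination (R : idomainType) (k : fieldType)
    (ev : {rmorphism R -> k}) (f p : {poly R}) :
  (1 < size f)%N -> ev (lead_coef f) != 0 -> map_poly ev p = 1 ->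
  exists r u v, ev r != 0 /\ r%:P = u * f + v * p.
Proof.
move=> sf lf pE.
(* The added multiple of [f] gives [g] the leading coefficient of [f], so the resultant of [f] and
   [g] commutes with [ev]. On the fibre [g] becomes 1 plus a multiple of the image of [f], hence
   coprime to it. *)
pose e := size p; pose g := p + 'X^(e.+1) * f.
have f0 : f != 0 by rewrite -size_poly_gt0 (ltn_trans _ sf).
have sXf : size ('X^(e.+1) * f) = (e.+1 + size f)%N.
  by rewrite mulrC size_mulXn.
have lt : (size p < size ('X^(e.+1) * f)%R)%N by rewrite sXf /e; lia.
have sg : size g = (e.+1 + size f)%N by rewrite /g addrC size_polyDl.
have lg : lead_coef g = lead_coef f.
  by rewrite /g addrC lead_coefDl // lead_coefM lead_coefXn mul1r.
have [||[u v] /= _ E] := @resultant_in_ideal _ f g => //.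
  by rewrite sg; lia.
exists (resultant f g), (u + v * 'X^(e.+1)), v; split; last by rewrite E /g; ring.
rewrite resultant_map ?lg // resultant_eq0 -leqNgt.
rewrite /g rmorphD rmorphM /= map_polyXn pE.
move: (map_poly ev f) => phi.
suff /eqP -> : coprimep phi (1 + 'X^(e.+1) * phi) by [].
apply/Bezout_eq1_coprimepP; exists (- 'X^(e.+1), 1) => /=.
by ring.
Qed.

Section PolyIdeal.
Variable k : closedFieldType.

(** An element of least size generates the ideal; a root of it would be a common zero, so it is a
    constant. *)
Lemma poly_ideal_nullstellensatz (I : {poly k} -> Prop) :
  (forall f g, I f -> I g -> I (f - g)) -> (forall f g, I f -> I (g * f)) ->
  (forall b, exists2 f, I f & f.[b] != 0) -> I 1.
Proof.
move=> IB IM nz.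
have [f1 If1 f1b] := nz 0.
have exI : exists s, `[< exists2 q, I q & q != 0 /\ size q = s >].
  exists (size f1); apply/asboolP; exists f1 => //; split=> //.
  by apply: contra_neq f1b => ->; rewrite horner0.
case: (ex_minnP exI) => s /asboolP[q Iq [q0 <-]] minq {exI}.
have dvd f : I f -> q %| f.
  move=> If; rewrite /dvdp; apply/negPn/negP => r0.
  have : (size (f %% q)%R < size q)%N by rewrite ltn_modp.
  rewrite ltnNge minq //; apply/asboolP; exists (f %% q) => //.
  have -> : f %% q = f - f %/ q * q by rewrite {2}(divp_eq f q) addrC addKr.
  by apply: IB => //; apply: IM.
have [sq|sq] := eqVneq (size q) 1%N.
  have /size1_polyC qE : (size q <= 1)%N by rewrite sq.
  have q00 : q`_0 != 0 by apply: contra_neq q0 => E; rewrite qE E.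
  suff -> : 1 = (q`_0)^-1%:P * q by apply: IM.
  by rewrite qE coefC /= -polyCM mulVf.
have /closed_rootP[b qb] := sq.
have [f If fb] := nz b; have /dvdpP[t fE] := dvd _ If.
by case/eqP: fb; rewrite fE hornerM (rootP qb) mulr0.
Qed.

End PolyIdeal.

Section Projective.
Variable k : closedFieldType.

Record homog_ideal n (J : {mpoly k[n]} -> Prop) : Prop := HomogIdeal {
  hid0 : J 0;
  hidD : forall f g, J f -> J g -> J (f + g);
  hidM : forall f g, J f -> J (g * f);
  hidH : forall d f, J f -> J (pihomog mdeg d f) }.

Lemma hidMr n (J : {mpoly k[n]} -> Prop) f g : homog_ideal J -> J f -> J (f * g).
Proof. by move=> hJ Jf; rewrite mulrC; apply: hidM. Qed.

Lemma hid_sum n (J : {mpoly k[n]} -> Prop) (T : Type) (r : seq T) (P : pred T) F :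
  homog_ideal J -> (forall i, P i -> J (F i)) -> J (\sum_(i <- r | P i) F i).
Proof. by move=> hJ H; apply: big_ind => //; [apply: hid0 | apply: hidD]. Qed.

Definition radical n (J : {mpoly k[n]} -> Prop) f := exists r, J (f ^+ r).

Lemma radicalD n (J : {mpoly k[n]} -> Prop) f g : homog_ideal J ->
  radical J f -> radical J g -> radical J (f + g).
Proof.
move=> hJ [r Jr] [s Js]; exists (r + s)%N; rewrite exprDn.
apply: hid_sum => // i _; rewrite -mulr_natl; apply: hidM => //.
have [ri|ir] := leqP r (r + s - i).
  by apply: hidMr => //; rewrite -(subnKC ri) exprD; apply: hidMr.
have si : (s <= i)%N by lia.
by apply: hidM => //; rewrite -(subnKC si) exprD; apply: hidMr.
Qed.

Lemma radicalM n (J : {mpoly k[n]} -> Prop) f g : homog_ideal J ->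
  radical J f -> radical J (g * f).
Proof. by move=> hJ [r Jr]; exists r; rewrite exprMn; apply: hidM. Qed.

Lemma pihomog_mwiden n d (p : {mpoly k[n]}) :
  pihomog mdeg d (mwiden p) = mwiden (pihomog mdeg d p).
Proof.
rewrite {1}(mpolyE p) [LHS](raddf_sum (pihomog mdeg d \o @mwiden n k)).
rewrite [in RHS](mpolyE p) [RHS](raddf_sum (@mwiden n k \o pihomog mdeg d)) /=.
apply: eq_bigr => m _; rewrite mwidenZ !linearZ /= mwidenZ; congr (_ *: _).
rewrite mwidenX !pihomogX /= mdeg_mnmwiden.
by case: eqP; rewrite ?mwidenX ?mwiden0.
Qed.

Lemma homog_ideal_mwiden n (J : {mpoly k[n.+1]} -> Prop) :
  homog_ideal J -> homog_ideal (fun p => J (mwiden p)).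
Proof.
move=> hJ; split=> [|f g Jf Jg|f g Jf|d f Jf].
- by rewrite mwiden0; apply: hid0.
- by rewrite mwidenD; apply: hidD.
- by rewrite mwidenM; apply: hidM.
by rewrite -pihomog_mwiden; apply: hidH.
Qed.

Section Step.
Variables (n : nat) (J : {mpoly k[n.+1]} -> Prop) (hJ : homog_ideal J).
Hypothesis J0 : forall v : 'I_n.+1 -> k, (exists i, v i != 0) ->
  exists2 f, J f & f.@[v] != 0.
Variables (D : nat) (f : {mpoly k[n.+1]}).
Hypotheses (Jf : J f) (homf : f \is D.-homog)
  (f0 : f.@[vjoin (fun=> 0) 1] != 0).

(** Up to a scalar, [f] is the [D]-th power of the last variable plus monomials that contain an
    earlier variable, and these lie in the radical. *)
Lemma radical_last :
  (forall i : 'I_n, radical J 'X_(widen_ord (leqnSn n) i)) ->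
  radical J 'X_ord_max.
Proof.
move=> Jw; have c0 := homog_last_coef homf f0.
set m1 := (U_(ord_max) *+ D)%MM in c0.
have m1f : m1 \in msupp f by rewrite mcoeff_msupp.
suff [r Jr] : radical J ('X_ord_max ^+ D).
  by exists (D * r)%N; rewrite exprM.
have -> : 'X_ord_max ^+ D = (f@_m1)^-1 *: f
    + (- (f@_m1)^-1)%:MP * \sum_(m <- rem m1 (msupp f)) f@_m *: 'X_[m].
  rewrite {2}(mpolyE f) (perm_big _ (perm_to_rem m1f)) big_cons /=.
  rewrite mul_mpolyC scaleNr scalerDr addrK scalerA mulVf // scale1r.
  by rewrite mpolyXn.
apply: radicalD => //.
  by exists 1%N; rewrite expr1 -mul_mpolyC; apply: hidM.
apply: radicalM => //; rewrite big_seq.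
apply: (big_ind (radical J)) => [||m]; first by exists 1%N; apply: hid0.
  by move=> x y; apply: radicalD.
rewrite mem_rem_uniq ?msupp_uniq // inE => /andP[ne mf].
rewrite -mul_mpolyC; apply: radicalM => //.
have [|j mj] := @mnm_widen_neq0 _ m; first by rewrite (dhomog_mf homf mf).
rewrite -(submK (_ : U_(widen_ord (leqnSn n) j) <= m)%MM) ?lep1mP //.
by rewrite mpolyXD; apply: radicalM.
Qed.

(** Elimination theory. Specializing [J] at [a] gives an ideal of k[X] without zeros, so some P in
    [J] specializes to 1; [unit_fiber_elimination] for [f] and P then yields an element of [J] free
    of the last variable and nonzero at [a]. *)
Lemma ideal_trace_no_zero (a : 'I_n -> k) : (exists i, a i != 0) ->
  exists2 p, J (mwiden p) & p.@[a] != 0.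
Proof.
move=> an0; apply: contrapT => H.
have Ja p : J (mwiden p) -> p.@[a] = 0.
  by move=> Jp; apply/eqP/negPn/negP => pa; apply: H; exists p.
have [c c0 [sf lf]] := homog_muni homf f0.
(* For D = 0 the ideal would contain a nonzero constant, which does not vanish at [a]. *)
have D0 : (0 < D)%N.
  rewrite lt0n; apply/eqP => D0.
  have fE : f = mwiden c%:MP.
    rewrite -(muniK f) [muni f]size1_polyC ?sf ?D0 // mjoinC.
    by move: lf; rewrite lead_coefE sf D0 /= => ->.
  by move: (Ja c%:MP); rewrite -fE mevalC => /(_ Jf) cE; rewrite cE eqxx in c0.
pose ev : {rmorphism {mpoly k[n]} -> k} := meval a.
pose I1 (g : {poly k}) := exists2 P, J P & g = map_poly ev (muni P).
have [|||P JP PE] := @poly_ideal_nullstellensatz k I1.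
- move=> _ _ [P JP ->] [Q JQ ->]; exists (P - Q); last first.
    by rewrite muniB (rmorphB (map_poly ev)).
  by apply: hidD => //; rewrite -mulN1r; apply: hidM.
- move=> _ g [P JP ->]; exists (mjoin (map_poly (@mpolyC n k) g) * P).
    exact: hidM.
  rewrite muniM (rmorphM (map_poly ev)) mjoinK /=; congr (_ * _).
  by rewrite -map_poly_comp map_poly_id // => x _ /=; rewrite mevalC.
- move=> b; have [|g Jg gb] := J0 (v := vjoin a b).
    by have [i ai] := an0; exists (widen_ord (leqnSn n) i); rewrite vjoin_widen.
  by exists (map_poly ev (muni g)); [exists g | rewrite -meval_muni].
have [|||r [u [v [r0 rE]]]] := @unit_fiber_elimination _ _ ev (muni f) (muni P).
- by rewrite sf.
- by rewrite lf /ev /= mevalC.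
- by rewrite -PE.
have JD (x y : {poly {mpoly k[n]}}) :
    J (mjoin x) -> J (mjoin y) -> J (mjoin (x + y)).
  by rewrite mjoinD; apply: hidD.
have JM (x y : {poly {mpoly k[n]}}) : J (mjoin y) -> J (mjoin (x * y)).
  by rewrite mjoinM; apply: hidM.
case/eqP: r0; apply: Ja; rewrite -mjoinC rE.
by apply: JD; apply: JM; rewrite muniK.
Qed.

End Step.

(** Induction on the variables: the elimination ideal again has no zero off the origin, which
    settles the earlier variables; a form in [J] that is nonzero at (0, ..., 0, 1) settles the last
    one. *)
Lemma projective_nullstellensatz n (J : {mpoly k[n]} -> Prop) :
  homog_ideal J ->
  (forall v : 'I_n -> k, (exists i, v i != 0) -> exists2 f, J f & f.@[v] != 0) ->
  forall i, radical J 'X_i.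
Proof.
elim: n J => [|n IH] J hJ J0; first by case.
have [|f Jf fe] := J0 (vjoin (fun=> 0) 1).
  by exists ord_max; rewrite vjoin_last oner_neq0.
have [d fd] : exists d, (pihomog mdeg d f).@[vjoin (fun=> 0) 1] != 0.
  apply: contrapT => /forallNP H; case/eqP: fe.
  rewrite (sum_pihomog f) (raddf_sum (meval _)) big1 // => d _.
  by apply/eqP/negPn/negP/H.
have Jfd : J (pihomog mdeg d f) by apply: hidH.
have hom := @pihomogP _ k mdeg d f.
have Jw i : radical J 'X_(widen_ord (leqnSn n) i).
  have [|r Jr] := IH _ (homog_ideal_mwiden hJ) _ i.
    exact: (ideal_trace_no_zero hJ J0 Jfd hom fd).
  by exists r; move: Jr; rewrite rmorphXn /= mwidenX mnmwiden1.
by apply: ord_widenP => //; apply: (radical_last hJ Jfd hom fd).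
Qed.

End Projective.

(** * Integrality over forms without a common zero off the origin *)

Section Integral.
Variables (k : closedFieldType) (n K e : nat) (h : K.-tuple {mpoly k[n]}).
Hypothesis e0 : (0 < e)%N.
Hypothesis homh : forall i, tnth h i \is e.-homog.
Hypothesis h0 : forall v : 'I_n -> k, (exists i, v i != 0) ->
  exists i, (tnth h i).@[v] != 0.

Let J (f : {mpoly k[n]}) := exists c, f = \sum_i tnth h i * c i.

Lemma homog_ideal_gen : homog_ideal J.
Proof.
split=> [|_ _ [c ->] [c' ->]|_ g [c ->]|d _ [c ->]].
- by exists (fun=> 0); rewrite big1 // => i _; rewrite mulr0.
- exists (fun i => c i + c' i); rewrite -big_split; apply: eq_bigr => i _.
  by rewrite mulrDr.
- exists (fun i => g * c i); rewrite mulr_sumr; apply: eq_bigr => i _.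
  by rewrite mulrCA.
have [ed|de] := leqP e d.
  exists (fun i => pihomog mdeg (d - e) (c i)).
  rewrite (raddf_sum (pihomog mdeg d)); apply: eq_bigr => i _ /=.
  by rewrite -{1}(subnKC ed) pihomogMl.
exists (fun=> 0); rewrite (raddf_sum (pihomog mdeg d)) /= !big1 // => i _.
  by rewrite mulr0.
by rewrite (pihomogMl_small _ (homh i)).
Qed.

Lemma power_decomposition : exists2 r, (0 < r)%N & forall i,
  exists2 c : 'I_K -> {mpoly k[n]},
  'X_i ^+ r = \sum_t tnth h t * c t & forall t, c t \is (r - e).-homog.
Proof.
have /choice[r Jr] : forall i, exists r, J ('X_i ^+ r).
  apply: (projective_nullstellensatz homog_ideal_gen) => v /h0[i hi].
  exists (tnth h i) => //; exists (fun t => (t == i)%:R).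
  rewrite (bigD1 i) //= eqxx mulr1 big1 ?addr0 // => t /negPf ->.
  by rewrite mulr0.
(* Large enough for every variable at once; the summand [e] makes the truncated difference s - e
   exact. *)
pose s := (e + \sum_i r i)%N; exists s; first by rewrite /s ltn_addr.
move=> i; have [c cE] := Jr i.
have ris : (r i <= s)%N by rewrite /s (bigD1 i) //=; lia.
exists (fun t => pihomog mdeg (s - e) (c t * 'X_i ^+ (s - r i))); last first.
  by move=> t; apply: pihomogP.
have hX : 'X_i ^+ s \is [in k[n], s.-homog].
  by rewrite mpolyXn dhomogX /= mdegMn mdeg1 mul1n.
rewrite -(pihomog_dE hX) -{2}(subnKC ris) exprD cE mulr_suml.
rewrite (raddf_sum (pihomog mdeg s)); apply: eq_bigr => t _ /=.
by rewrite -mulrA -{1}(subnKC (_ : e <= s)%N) ?leq_addr // pihomogMl.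
Qed.

Section Span.
Variable r : nat.
Local Notation box := {ffun 'I_n -> 'I_r}.
Let bX (b : box) : {mpoly k[n]} := 'X_[[multinom val (b i) | i < n]].
Let span (f : {mpoly k[n]}) :=
  exists A : box -> {mpoly k[K]}, f = \sum_b (A b \mPo h) * bX b.

Lemma spanD f g : span f -> span g -> span (f + g).
Proof.
move=> [A ->] [B ->]; exists (fun b => A b + B b); rewrite -big_split.
by apply: eq_bigr => b _; rewrite comp_mpolyD mulrDl.
Qed.

Lemma span_comp G f : span f -> span ((G \mPo h) * f).
Proof.
move=> [A ->]; exists (fun b => G * A b); rewrite mulr_sumr.
by apply: eq_bigr => b _; rewrite rmorphM mulrA.
Qed.

Lemma span0 : span 0.
Proof. by exists (fun=> 0); rewrite big1 // => b _; rewrite comp_mpoly0 mul0r. Qed.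

Lemma spanZ a f : span f -> span (a *: f).
Proof. by move=> /(span_comp a%:MP); rewrite comp_mpolyC mul_mpolyC. Qed.

Lemma span_homog d : (forall m, mdeg m = d -> span 'X_[m]) ->
  forall f, f \is d.-homog -> span f.
Proof.
move=> H f /dhomogP hf; rewrite (mpolyE f) big_seq.
apply: (big_ind span); [exact: span0 | exact: spanD|].
by move=> m /hf md; apply/spanZ/H.
Qed.

Hypothesis r0 : (0 < r)%N.
Hypothesis dec : forall i, exists2 c : 'I_K -> {mpoly k[n]},
  'X_i ^+ r = \sum_t tnth h t * c t &
  forall t, c t \is (r - e).-homog.

(** Induction on the degree: a monomial outside the box contains the [r]-th power of some variable,
    and [dec] trades it for factors h_t times forms of strictly smaller degree, as r - e < r. *)
Lemma span_mono m : span 'X_[m].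
Proof.
move: {2}(mdeg m).+1 (ltnSn (mdeg m)) => N.
elim: N m => // N IH m; rewrite ltnS => mN.
case: (pselect (forall i, m i < r)%N) => [mr|/existsNP[i /negP]].
  pose b0 : box := [ffun i => Ordinal (mr i)].
  exists (fun b => (b == b0)%:R); rewrite (bigD1 b0) //= eqxx comp_mpoly1 mul1r.
  rewrite big1 ?addr0 => [|b /negPf ->]; last by rewrite comp_mpoly0 mul0r.
  by congr 'X_[_]; apply/mnmP => j; rewrite mnmE ffunE.
rewrite -leqNgt => rm.
have le : (U_(i) *+ r <= m)%MM.
  by apply/mnm_lepP => j; rewrite mulmnE mnm1E; case: eqP => [<-|]; rewrite ?mul1n.
have [c cE ch] := dec i.
rewrite -(submK le) mpolyXD -mpolyXn cE mulr_sumr.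
apply: (big_ind span); [exact: span0 | exact: spanD|] => t _.
have -> : 'X_[m - U_(i) *+ r] * (tnth h t * c t) =
    ('X_t \mPo h) * ('X_[m - U_(i) *+ r] * c t).
  by rewrite comp_mpolyXU -tnth_nth mulrCA.
apply: span_comp; set m' := (m - _)%MM.
apply: (@span_homog (mdeg m' + (r - e))); last first.
  by apply: dhomogM (ch t); rewrite dhomogX.
move=> m1 m1E; apply: IH; rewrite m1E.
have mE : mdeg m = (mdeg m' + r)%N.
  by rewrite -{1}(submK le) mdegD mdegMn mdeg1 mul1n.
by apply: leq_trans mN; rewrite mE ltn_add2l; lia.
Qed.

Lemma span_all f : span f.
Proof.
rewrite (mpolyE f); apply: (big_ind span); [exact: span0 | exact: spanD|].
by move=> m _; apply/spanZ/span_mono.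
Qed.

(* Multiplication by 'X_i on the k[h]-module spanned by the box monomials has a
   characteristic polynomial that kills 'X_i. *)
Lemma integral_of_dec i : exists2 chi : {poly {mpoly k[K]}},
  chi \is monic & (map_poly (comp_mpoly h) chi).['X_i] = 0.
Proof.
have /choice[A AE] : forall b : box, exists A : box -> {mpoly k[K]},
    'X_i * bX b = \sum_b' (A b' \mPo h) * bX b'.
  by move=> b; apply: span_all.
pose M := \matrix_(s < #|{: box}|, t < #|{: box}|) A (enum_val s) (enum_val t).
exists (char_poly M); first exact: char_poly_monic.
pose N := map_mx (comp_mpoly h) M.
pose w := \col_(s < #|{: box}|) bX (enum_val s).
have Nw : (('X_i)%:M - N) *m w = 0.
  apply/matrixP => s z; rewrite mulmxBl mul_scalar_mx !mxE AE.
  rewrite (reindex _ (onW_bij _ (enum_val_bij _))) /=.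
  by apply/eqP; rewrite subr_eq0; apply/eqP/eq_bigr => t _; rewrite !mxE.
have : \det (('X_i)%:M - N) *: w = 0.
  by rewrite -mul_scalar_mx -mul_adj_mx -mulmxA Nw mulmx0.
(* The box monomial with all exponents 0 is 1, so this coordinate of the vanishing vector is the
   determinant itself. *)
move/matrixP/(_ (enum_rank [ffun=> Ordinal r0]) 0); rewrite !mxE enum_rankK.
rewrite /bX (_ : [multinom _ | _ < _] = 0%MM) ?mpolyX0 ?mulr1; last first.
  by apply/mnmP => j; rewrite mnmE ffunE mnm0E.
move=> det0; rewrite map_char_poly /char_poly -/N -horner_evalE -det_map_mx -det0.
congr (\det _); apply/matrixP => s t; rewrite !mxE /=.
by rewrite horner_evalE hornerD hornerN hornerMn hornerX hornerC.
Qed.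

End Span.

Lemma coordinate_integral i : exists2 chi : {poly {mpoly k[K]}},
  chi \is monic & (map_poly (comp_mpoly h) chi).['X_i] = 0.
Proof. by have [r r0 dec] := power_decomposition; apply: (@integral_of_dec r). Qed.

End Integral.

(** * Algebraic dependence *)

Section AlgebraicDependence.
Variables (k : fieldType) (n r : nat) (p : r.-tuple {mpoly k[n]}).

(** With c = r d + 1 the left side is at most (c s)^n; a choice of s above c^n puts this below
    s^(n+1), hence below s^r. *)
Lemma counting_bound d : (n < r)%N ->
  exists s, ((r * s * d).+1 ^ n < s ^ r)%N.
Proof.
move=> nr; pose c := (r * d).+1; pose s := (c ^ n).+1; exists s.
have le : ((r * s * d).+1 <= c * s)%N.
  by rewrite /c mulSn mulnAC addnC -addn1 leq_add2l.
have le1 : ((r * s * d).+1 ^ n <= (c * s) ^ n)%N.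
  by case: (posnP n) => [->//|n0]; rewrite leq_exp2r.
apply: leq_ltn_trans le1 _; rewrite expnMn.
apply: (@leq_trans (s ^ n.+1)); last by rewrite leq_exp2l // ltnS expn_gt0.
by rewrite expnS ltn_pmul2r ?expn_gt0.
Qed.

Lemma msizeM_bound (f g : {mpoly k[n]}) a b :
  (msize f <= a.+1)%N -> (msize g <= b.+1)%N -> (msize (f * g)%R <= (a + b).+1)%N.
Proof.
have [->|f0] := eqVneq f 0; first by rewrite mul0r mmeasure0.
have [->|g0] := eqVneq g 0; first by rewrite mulr0 mmeasure0.
by rewrite msizeM //; move: (msize f) (msize g) => u v; lia.
Qed.

Lemma msize_prod_le (I : finType) (q : I -> {mpoly k[n]}) (a : I -> nat) d :
  (forall i, msize (q i) <= d.+1)%N ->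
  (msize (\prod_i q i ^+ a i) <= ((\sum_i a i) * d).+1)%N.
Proof.
move=> sq; rewrite big_distrl /=.
elim/big_ind2: _ => [|x1 x2 y1 y2 s1 s2|i _]; first by rewrite msize1.
  exact: msizeM_bound.
elim: (a i) => [|b IH]; first by rewrite expr0 msize1.
by rewrite exprS mulSn; apply: msizeM_bound.
Qed.

(** Counting: the s^r products of the p_i with exponents below s have degree at most r s d, so they
    lie in a space of dimension at most (r s d + 1)^n < s^r and satisfy a linear relation. *)
Lemma algebraic_dependence : (n < r)%N ->
  exists2 Q : {mpoly k[r]}, Q != 0 & Q \mPo p = 0.
Proof.
move=> nr; pose d := \max_i msize (tnth p i).
have sp i : (msize (tnth p i) <= d.+1)%N by apply/leqW/leq_bigmax.
have [s sE] := counting_bound d nr; pose B := (r * s * d).+1.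
pose rowT := {ffun 'I_r -> 'I_s}; pose colT := {ffun 'I_n -> 'I_B}.
have lt : (#|{: colT}| < #|{: rowT}|)%N by rewrite !card_ffun !card_ord.
pose mon (a : rowT) : 'X_{1..r} := [multinom val (a i) | i < r].
pose mon' (b : colT) : 'X_{1..n} := [multinom val (b i) | i < n].
pose M := \matrix_(a < #|{: rowT}|, b < #|{: colT}|)
  ('X_[mon (enum_val a)] \mPo p)@_(mon' (enum_val b)).
have /rowV0Pn[v /sub_kermxP vM v0] : kermx M != 0.
  rewrite -mxrank_eq0 mxrank_ker subn_eq0 -ltnNge.
  exact: leq_ltn_trans (rank_leq_col M) lt.
exists (\sum_a v 0 a *: 'X_[mon (enum_val a)]).
  have [a va] : exists a, v 0 a != 0 by apply/rV0Pn.
  apply: contra_neq va => /(congr1 (mcoeff (mon (enum_val a)))).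
  rewrite mcoeff0 raddf_sum /= (bigD1 a) //= mcoeffZ mcoeffX eqxx mulr1.
  rewrite big1 ?addr0 // => b ba; rewrite mcoeffZ mcoeffX.
  case: eqP => [E|]; last by rewrite mulr0.
  case/eqP: ba; apply: enum_val_inj; apply/ffunP => i; apply: val_inj.
  by have := congr1 (fun m : 'X_{1..r} => m i) E; rewrite !mnmE.
rewrite (raddf_sum (comp_mpoly p)) /=; apply/mpolyP => m.
rewrite mcoeff0 raddf_sum /=.
case: (pselect (forall i, m i < B)%N) => [mB|/existsNP[i /negP]].
  pose b : colT := [ffun i => Ordinal (mB i)].
  have := congr1 (fun A : 'rV[k]_ _ => A 0 (enum_rank b)) vM.
  rewrite !mxE => E; rewrite -[RHS]E; apply: eq_bigr => a _.
  rewrite comp_mpolyZ mcoeffZ mxE enum_rankK; congr (_ * _ @_ _).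
  by apply/mnmP => i; rewrite mnmE ffunE.
(* An exponent of at least [B] exceeds the degree of every product, so the matrix [M] has recorded
   all coefficients. *)
rewrite -leqNgt => Bm; rewrite big1 // => a _.
rewrite comp_mpolyZ mcoeffZ memN_msupp_eq0 ?mulr0 //.
apply: msize_mdeg_ge; apply: leq_trans (_ : (B <= mdeg m)%N); last first.
  by apply: leq_trans Bm _; rewrite mdegE (bigD1 i) //= leq_addr.
rewrite comp_mpolyX; apply: leq_trans (msize_prod_le _ sp) _.
rewrite ltnS leq_mul2r; apply/orP; right.
have -> : (r * s)%N = (\sum_(j < r) s)%N by rewrite sum_nat_const card_ord.
by apply: leq_sum => j _; rewrite mnmE ltnW // ltn_ord.
Qed.

End AlgebraicDependence.

(** * Krull dimension of the image of a homogeneous map *)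

Lemma poly_lowest_factor (R : idomainType) (P : {poly R}) : P != 0 ->
  exists a P', [/\ P = P' * 'X^a, P'`_0 = P`_a & P`_a != 0].
Proof.
move=> P0; have ex : exists a, P`_a != 0.
  by exists (size P).-1; rewrite -lead_coefE lead_coef_eq0.
case: (ex_minnP ex) => a Pa mina; exists a, (drop_poly a P).
split=> //; last by rewrite coef_drop_poly add0n.
rewrite -{1}(poly_take_drop a P) [take_poly _ _](_ : _ = 0) ?add0r //.
apply/polyP => i; rewrite coef_take_poly coef0; case: ltnP => // ia.
by apply/eqP/negPn/negP => /mina; rewrite leqNgt ia.
Qed.

Lemma comp_mpoly_comp (R : idomainType) a b c (G : {mpoly R[a]})
    (f : a.-tuple {mpoly R[b]}) (g : b.-tuple {mpoly R[c]}) :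
  (G \mPo f) \mPo g = G \mPo [tuple tnth f i \mPo g | i < a].
Proof.
rewrite (comp_mpolyEX G f) (raddf_sum (comp_mpoly g)) /= [RHS]comp_mpolyEX.
apply: eq_bigr => m _; rewrite comp_mpolyZ; congr (_ *: _).
rewrite !comp_mpolyX (rmorph_prod (comp_mpoly g)); apply: eq_bigr => i _.
by rewrite tnth_mktuple rmorphXn.
Qed.

Section KrullOfImage.
Variables (k : closedFieldType) (T : Type) (K : nat) (Pl : T -> 'I_K -> k).

(** For [T] the Grassmannian and [Pl] the Pluecker coordinates this is [gr_closed] by conversion. *)
Definition pl_closed (Z : set T) : Prop :=
  exists2 E : set {mpoly k[K]}, (forall f, E f -> exists e, f \is e.-homog) &
    Z = [set W | forall f, E f -> f.@[Pl W] = 0].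

Lemma pl_closed_hyper d f : f \is d.-homog -> pl_closed [set t | f.@[Pl t] = 0].
Proof.
move=> hf; exists [set f]; first by move=> _ ->; exists d.
by apply/seteqP; split=> t /= H; [move=> _ -> | apply: H].
Qed.

Lemma pl_closedT : pl_closed setT.
Proof. by exists set0 => [f []|]; apply/seteqP; split=> t // _ f []. Qed.

Variables (Y : set T) (n e : nat) (h : K.-tuple {mpoly k[n.+1]}).
Hypothesis homh : forall i, tnth h i \is e.-homog.
Hypothesis h0 : forall x : 'I_n.+1 -> k, (exists i, x i != 0) ->
  exists i, (tnth h i).@[x] != 0.

(** Equality of h(x) and [Pl t] as homogeneous coordinates. *)
Definition lies_over (x : 'I_n.+1 -> k) (t : T) :=
  exists2 c, c != 0 & forall i, (tnth h i).@[x] = c * Pl t i.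

Hypothesis Yover : forall x : 'I_n.+1 -> k, (exists i, x i != 0) ->
  exists2 t, Y t & lies_over x t.
Hypothesis overY : forall t, Y t ->
  exists2 x : 'I_n.+1 -> k, (exists i, x i != 0) & lies_over x t.

Lemma over_vanish x t d f : lies_over x t -> f \is d.-homog ->
  f.@[Pl t] = 0 <-> (f \mPo h).@[x] = 0.
Proof.
case=> c c0 hx hf; rewrite comp_mpoly_meval (mevalZ_homog hf hx).
by split=> [->|/eqP]; rewrite ?mulr0 // mulf_eq0 expf_eq0 (negPf c0) andbF => /eqP.
Qed.

Lemma over_coord x t : (exists i, x i != 0) -> lies_over x t -> exists i, Pl t i != 0.
Proof.
move=> /h0[i hi] [c c0 /(_ i) E]; exists i.
by apply: contra_neq hi => E0; rewrite E E0 mulr0.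
Qed.

Lemma Y_nonempty : Y !=set0.
Proof.
have [|t Yt _] := Yover (x := fun=> 1); last by exists t.
by exists ord0; rewrite oner_neq0.
Qed.

(** Forms of degree 0 are constants, so all points of [Y] have proportional coordinates and lie in
    the same closed sets: the topology of [Y] is indiscrete. *)
Lemma krull_dim_const : e = 0%N -> has_krull_dim pl_closed Y 0.
Proof.
move=> e0; have indist C t t' : pl_closed C -> Y t -> Y t' -> C t -> C t'.
  case=> E homE -> Yt Yt' /= H f Ef; have [d hf] := homE f Ef.
  have [x x0 xt] := overY Yt; have [x' x0' xt'] := overY Yt'.
  apply/(over_vanish xt' hf); have /(over_vanish xt hf) := H f Ef.
  rewrite !comp_mpoly_meval; congr (_ = 0); apply: meval_eq => i.
  have h1 : (msize (tnth h i) <= 1)%N.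
    rewrite msizeE; apply/bigmax_leqP_seq => m mh _.
    by have := dhomog_mf (homh i) mh; rewrite e0 /= => ->.
  by rewrite (msize1_polyC h1) !mevalC.
have irr Z : (forall t t', Z t -> Z t' -> Y t /\ Y t') -> Z !=set0 ->
    irreducible_set pl_closed Z.
  move=> ZY [t Zt]; split; first by exists t.
  move=> C D clC clD /(_ t Zt)[Ct|Dt]; [left|right] => t' Zt';
    have [Yt Yt'] := ZY _ _ Zt Zt'; exact: indist Yt Yt' _.
split=> // m; split=> [[Z [Zcl Zlt]]|].
  case: m Zcl Zlt => // m Zcl Zlt; exfalso.
  have [[C clC CE] [[t Zt] _]] := Zcl 0%N isT.
  have [[C' clC' CE'] _] := Zcl 1%N isT.
  have [_ nsub] := Zlt 0%N isT; apply: nsub => t'.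
  rewrite CE' => -[Yt' _]; move: Zt; rewrite CE => -[Yt Ct].
  by split=> //; apply: indist Yt Yt' Ct.
rewrite lez_nat leqn0 => /eqP ->; exists (fun=> Y); split=> // i _.
split; first by exists setT; [apply: pl_closedT | rewrite setIT].
by apply: irr => //; apply: Y_nonempty.
Qed.

Hypothesis e0 : (0 < e)%N.

(** * Upper bound for the length of chains *)

Section Upper.
Variables (q : nat) (Z : nat -> set T) (chainZ : irreducible_chain pl_closed Y q Z).

(** For i = 0 a coordinate serves. Otherwise it is a defining form of Z_(i-1) that is nonzero
    somewhere on Z_i; a constant form is excluded because it vanishes on the nonempty Z_(i-1). *)
Lemma chain_separating i : (i <= q)%N -> exists f d, [/\ f \is d.-homog, (0 < d)%N,
  exists2 t, Z i t & f.@[Pl t] != 0 &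
  (0 < i)%N -> forall t, Z i.-1 t -> f.@[Pl t] = 0].
Proof.
case: chainZ => Zcl Zlt; case: i => [|i] iq.
  have [[C clC CE] [[t Zt] _]] := Zcl 0%N isT.
  have Yt : Y t by move: Zt; rewrite CE => -[].
  have [x x0 xt] := overY Yt; have [j Plj] := over_coord x0 xt.
  exists 'X_j, 1%N; split=> //; first by rewrite dhomogX /= mdeg1.
  by exists t => //; rewrite mevalXU.
have [[C [E homE CE] ZE] [[t0 Zt0] _]] := Zcl i (ltnW iq).
have [[C' clC' ZE'] _] := Zcl i.+1 iq.
have [_ /existsNP[t /not_implyP[Zt nZt]]] := Zlt i iq.
have Yt : Y t by move: Zt; rewrite ZE' => -[].
have [f /not_implyP[Ef /eqP ft]] : exists f, ~ (E f -> f.@[Pl t] = 0).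
  by apply/existsNP => H; apply: nZt; rewrite ZE CE.
have [d hf] := homE f Ef; exists f, d.
have f0 t' : Z i t' -> f.@[Pl t'] = 0 by rewrite ZE CE => -[_ /(_ f Ef)].
split=> //; last by exists t.
rewrite lt0n; apply/eqP => d0; case/eqP: ft.
have f1 : (msize f <= 1)%N.
  rewrite msizeE; apply/bigmax_leqP_seq => m mh _.
  by have := dhomog_mf hf mh; rewrite d0 /= => ->.
by have := f0 t0 Zt0; rewrite (msize1_polyC f1) !mevalC.
Qed.

Lemma chain_same_degree : exists2 D, (0 < D)%N & exists f : nat -> {mpoly k[K]},
  forall i, (i <= q)%N -> [/\ f i \is D.-homog,
  exists2 t, Z i t & (f i).@[Pl t] != 0 &
  (0 < i)%N -> forall t, Z i.-1 t -> (f i).@[Pl t] = 0].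
Proof.
have /choice[f /choice[d fd]] : forall i, exists f d, (i <= q)%N ->
    [/\ f \is d.-homog, (0 < d)%N, exists2 t, Z i t & f.@[Pl t] != 0 &
    (0 < i)%N -> forall t, Z i.-1 t -> f.@[Pl t] = 0].
  move=> i; case: (leqP i q) => [iq|]; last by exists 0, 0%N.
  by have [f [d H]] := chain_separating iq; exists f, d.
(* Raising the i-th form to the positive power D / d_i equalizes the degrees and keeps the zero
   sets. *)
pose D := (\prod_(i < q.+1) d i)%N.
have D0 : (0 < D)%N.
  by apply: prodn_cond_gt0 => i _; have [] := fd i (ltn_ord i).
exists D => //; exists (fun i => f i ^+ (D %/ d i)) => i iq.
have [hf d0 [t Zt ft] f0] := fd i iq.
have dD : (d i %| D)%N.
  by rewrite /D (bigD1 (Ordinal (iq : (i < q.+1)%N))) //= dvdn_mulr.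
have Dd0 : (0 < D %/ d i)%N by rewrite divn_gt0 // dvdn_leq.
split; first by have := dhomogMn (D %/ d i) hf; rewrite mulnC divnK.
  by exists t => //; rewrite rmorphXn expf_neq0.
by move=> i0 t' Zt'; rewrite rmorphXn /= f0 // expr0n gtn_eqF.
Qed.

Variables (D : nat) (f : nat -> {mpoly k[K]}).
Hypothesis fP : forall i, (i <= q)%N -> [/\ f i \is D.-homog,
  exists2 t, Z i t & (f i).@[Pl t] != 0 &
  (0 < i)%N -> forall t, Z i.-1 t -> (f i).@[Pl t] = 0].

(** The last condition means that [Q'] stays nonzero when the last variable is set to 0. *)
Lemma mpoly_last_factor r (Q : {mpoly k[r.+1]}) d : Q != 0 -> Q \is d.-homog ->
  exists a Q', [/\ Q = Q' * 'X_ord_max ^+ a, Q' \is (d - a).-homog &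
    (muni Q')`_0 != 0].
Proof.
move=> Q0 hQ; have P0 : muni Q != 0.
  by apply: contra_neq Q0 => E; rewrite -(muniK Q) E rmorph0.
have [a [P' [E P'0 Pa]]] := poly_lowest_factor P0; exists a, (mjoin P').
have QE : Q = mjoin P' * 'X_ord_max ^+ a.
  by rewrite -{1}(muniK Q) E mjoinM rmorphXn /= mjoinX.
split=> //; last by rewrite mjoinK P'0.
apply/dhomog_coefP => m; rewrite -(mcoeffMX _ (U_(ord_max) *+ a)%MM) -mpolyXn -QE.
move/dhomog_coefP: hQ => hQ /hQ; rewrite mdegD mdegMn mdeg1 mul1n => <-.
by rewrite addKn.
Qed.

(** Induction along the chain. In a relation on Z_(i+1), the power of f_(i+1) can be cancelled
    because Z_(i+1) is irreducible and f_(i+1) is not zero on it. On Z_i, where f_(i+1) vanishes,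
    the rest becomes a nonzero relation among f_0, ..., f_i. *)
Lemma chain_independent i (Q : {mpoly k[i.+1]}) d : (i <= q)%N -> Q \is d.-homog ->
  (forall t, Z i t -> Q.@[fun j => (f j).@[Pl t]] = 0) -> Q = 0.
Proof.
elim: i Q d => [|i IH] Q d iq hQ QZ; apply/eqP/negPn/negP => Q0.
  have [_ [t Zt ft] _] := fP iq; have := QZ t Zt.
  (* A form of degree [d] in one variable has the value c^d Q(1) at c, so one zero at a nonzero c
     makes it vanish everywhere. *)
  rewrite (mevalZ_homog (v := fun=> 1) (c := (f 0%N).@[Pl t]) hQ); last first.
    by move=> j; rewrite mulr1 (ord1 j).
  move/eqP; rewrite mulf_eq0 expf_eq0 (negPf ft) andbF /= => /eqP Q1.
  have [v /eqP[]] := mpoly_neq0_point Q0.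
  rewrite (mevalZ_homog (v := fun=> 1) (c := v ord0) hQ) ?Q1 ?mulr0 // => j.
  by rewrite mulr1 (ord1 j).
have [a [Q' [QE hQ' Q'0]]] := mpoly_last_factor Q0 hQ.
have [hf [t1 Zt1 ft1] f0] := fP iq.
have [Zcl Zlt] := chainZ; have [_ [_ irr]] := Zcl i.+1 iq.
pose ft : i.+2.-tuple {mpoly k[K]} := [tuple f j | j < i.+2].
have hft j : tnth ft j \is D.-homog.
  have jq : (j <= q)%N by have := ltn_ord j; lia.
  by rewrite tnth_mktuple; have [] := fP jq.
have evQ' t : (Q' \mPo ft).@[Pl t] = Q'.@[fun j => (f j).@[Pl t]].
  by rewrite comp_mpoly_meval; apply: meval_eq => j; rewrite tnth_mktuple.
have sub : Z i.+1 `<=` [set t | (f i.+1).@[Pl t] = 0] `|`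
    [set t | (Q' \mPo ft).@[Pl t] = 0].
  move=> t Zt; have := QZ t Zt; rewrite QE mevalM rmorphXn /= mevalXU => /eqP.
  rewrite mulf_eq0 expf_eq0 => /orP[/eqP Et|/andP[_ /eqP Et]]; [right|left] => //=.
  by rewrite evQ'.
have [|H] := irr _ _ (pl_closed_hyper hf) (pl_closed_hyper (dhomog_comp hft hQ')) sub.
  by move=> /(_ t1 Zt1) /= E; rewrite E eqxx in ft1.
case/eqP: Q'0; apply: (IH _ (d - a)%N (ltnW iq)).
  apply/dhomog_coefP => m; rewrite coef_muni => /(proj2 (dhomog_coefP _ _) hQ').
  by rewrite mdeg_mnmcat addn0.
move=> t Zt; have [Zsub _] := Zlt i iq.
have := H t (Zsub t Zt); rewrite /= evQ'.
rewrite (meval_vjoin (v := fun j => (f (widen_ord (leqnSn i.+1) j)).@[Pl t])) //.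
rewrite meval_muni /= f0 // horner_coef0 coef_map /= => <-.
by apply: meval_eq.
Qed.

End Upper.

(** For q > n the q + 1 forms f_j(h) in n + 1 variables are algebraically dependent. Their common
    degree D e is positive, so each homogeneous component of the relation holds as well, against
    [chain_independent]. *)
Lemma krull_upper q Z : irreducible_chain pl_closed Y q Z -> (q <= n)%N.
Proof.
move=> ch; have [D D0 [f fP]] := chain_same_degree ch.
rewrite leqNgt; apply/negP => nq.
pose p : q.+1.-tuple {mpoly k[n.+1]} := [tuple f j \mPo h | j < q.+1].
have hp j : tnth p j \is (D * e).-homog.
  rewrite tnth_mktuple; apply: dhomog_comp => //.
  by have [] := fP j (ltn_ord j).
have [|Q Q0 Qp] := @algebraic_dependence k n.+1 q.+1 p; first by [].
have [d Qd] := pihomog_neq0 Q0.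
case/eqP: Qd; apply: (chain_independent ch fP (leqnn q) (pihomogP mdeg d Q)).
move=> t Zt; have [[C clC CE] _] := ch.1 q (leqnn q).
have Yt : Y t by move: Zt; rewrite CE => -[].
have [x x0 xt] := overY Yt.
pose ft : q.+1.-tuple {mpoly k[K]} := [tuple f j | j < q.+1].
have hft j : tnth ft j \is D.-homog.
  by rewrite tnth_mktuple; have [] := fP j (ltn_ord j).
have -> : (pihomog mdeg d Q).@[fun j : 'I_q.+1 => (f j).@[Pl t]] =
    (pihomog mdeg d Q \mPo ft).@[Pl t].
  by rewrite comp_mpoly_meval; apply: meval_eq => j; rewrite tnth_mktuple.
apply/(over_vanish xt (dhomog_comp hft (pihomogP mdeg d Q))).
have : (pihomog mdeg d Q \mPo p).@[x] = 0.
  by rewrite -(pihomog_comp _ _ _ hp) ?muln_gt0 ?D0 // Qp pihomog0 meval0.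
rewrite !comp_mpoly_meval => E; rewrite -[RHS]E; apply: meval_eq => j.
by rewrite !tnth_mktuple comp_mpoly_meval.
Qed.

(** * Lower bound from the flag of coordinate subspaces *)

Definition trunc i : n.+1.-tuple {mpoly k[n.+1]} :=
  [tuple if (j <= i)%N then 'X_j else 0 | j < n.+1].

Definition htrunc i : K.-tuple {mpoly k[n.+1]} :=
  [tuple tnth h s \mPo trunc i | s < K].

Definition ptrunc i (x : 'I_n.+1 -> k) (j : 'I_n.+1) : k :=
  if (j <= i)%N then x j else 0.

Lemma meval_htrunc i G x : (G \mPo htrunc i).@[x] = (G \mPo h).@[ptrunc i x].
Proof.
rewrite -comp_mpoly_comp comp_mpoly_meval; apply: meval_eq => j.
rewrite tnth_mktuple /ptrunc; case: ifP => _; by rewrite ?mevalXU ?meval0.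
Qed.

Lemma htruncS i G : (G \mPo htrunc i.+1) \mPo trunc i = G \mPo htrunc i.
Proof.
have E j : G \mPo htrunc j = (G \mPo h) \mPo trunc j by rewrite comp_mpoly_comp.
rewrite !E (comp_mpoly_comp (G \mPo h)); congr (comp_mpoly _ _).
apply: eq_from_tnth => j; rewrite !tnth_mktuple.
case: ifP => [_|]; first by rewrite comp_mpolyXU -tnth_nth tnth_mktuple.
by case: ifP => [/leqW ->//|_ _]; rewrite comp_mpoly0.
Qed.

Lemma htrunc_homog i s : tnth (htrunc i) s \is e.-homog.
Proof.
rewrite tnth_mktuple -[e]muln1; apply: dhomog_comp => // j.
rewrite tnth_mktuple; case: ifP => _; last exact: dhomog0.
by rewrite dhomogX /= mdeg1.
Qed.

(* The closure in Y of the image of the linear subspace on which all the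
   coordinates of index larger than i vanish. *)
Definition flag_image i : set T := Y `&` [set t | forall G,
  (exists d, G \is d.-homog) /\ G \mPo htrunc i = 0 -> G.@[Pl t] = 0].

Lemma flag_image_closed i : closed_in pl_closed Y (flag_image i).
Proof.
eexists; last by [].
by exists [set G | (exists d, G \is d.-homog) /\ G \mPo htrunc i = 0] => // G [].
Qed.

Lemma flag_image_point i (v : 'I_n.+1 -> k) : v ord0 != 0 ->
  exists2 t, flag_image i t & lies_over (ptrunc i v) t.
Proof.
move=> v0; have [|t Yt vt] := Yover (x := ptrunc i v); first by exists ord0.
exists t => //; split=> // G [[d hG] G0]; apply/(over_vanish vt hG).
by rewrite -meval_htrunc G0 meval0.
Qed.

Lemma flag_image_sub i : flag_image i `<=` flag_image i.+1.
Proof.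
move=> t [Yt H]; split; first exact: Yt.
move=> G [hG G0]; apply: (H G); split; first exact: hG.
by rewrite -htruncS G0 comp_mpoly0.
Qed.

(** If neither inclusion holds, there are two forms, vanishing on [C] and on [D], with nonzero
    pullbacks. The product of the pullbacks is nonzero at some vector, and the point over it lies in
    neither set. *)
Lemma flag_image_irreducible i : irreducible_set pl_closed (flag_image i).
Proof.
split.
  have [|t Zt _] := @flag_image_point i (fun=> 1); last by exists t.
  exact: oner_neq0.
move=> C D clC clD sub; apply: contrapT => /not_orP[nC nD].
have witness B : pl_closed B -> ~ (flag_image i `<=` B) -> exists f d,
    [/\ f \is d.-homog, f \mPo htrunc i != 0 & forall t, B t -> f.@[Pl t] = 0].
  move=> [E homE ->] /existsNP[t /not_implyP[[Yt Zt]]].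
  move=> /existsNP[f /not_implyP[Ef ft]]; have [d hf] := homE f Ef.
  exists f, d; split=> [//||t' /(_ f Ef)//].
  by apply/eqP => f0; apply/ft/Zt; split=> //; exists d.
have [f [d [hf f0 fC]]] := witness C clC nC.
have [g [d' [hg g0 gD]]] := witness D clD nD.
have [v v0] := mpoly_neq0_nonzero_point (mulf_neq0 f0 g0).
rewrite mevalM mulf_eq0 negb_or !meval_htrunc => /andP[/eqP fv /eqP gv].
have [t Zt vt] := flag_image_point i v0.
by have [/fC/(over_vanish vt hf)|/gD/(over_vanish vt hg)] := sub t Zt.
Qed.

(* The lowest nonzero coefficient of an integral equation of the coordinate
   i.+1 over k[h] vanishes on the hyperplane where this coordinate is zero. *)
Lemma flag_separating i : (i < n)%N -> exists G d,
  [/\ G \is d.-homog, G \mPo htrunc i = 0 & G \mPo htrunc i.+1 != 0].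
Proof.
move=> lt; have lt' : (i.+1 < n.+1)%N by [].
pose j := Ordinal lt'.
have [chi chi1 chi0] := coordinate_integral e0 homh h0 j.
pose P := map_poly (comp_mpoly (htrunc i.+1)) chi.
have Pj : P.['X_j] = 0.
  have := congr1 (comp_mpoly (trunc i.+1)) chi0.
  rewrite comp_mpoly0 -horner_map /= comp_mpolyXU -tnth_nth tnth_mktuple leqnn.
  rewrite -map_poly_comp => <-; congr (_.[_]); apply: eq_map_poly => G /=.
  by rewrite comp_mpoly_comp.
have P0 : P != 0 by apply/monic_neq0/monic_map.
have [a [P' [PE P'0 Pa]]] := poly_lowest_factor P0.
have P'j : P'.['X_j] = 0.
  have := Pj; rewrite PE hornerM hornerXn => /eqP; rewrite mulf_eq0 => /orP[/eqP//|].
  rewrite expf_eq0 => /andP[_ /eqP/(congr1 (mcoeff U_(j)))/eqP].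
  by rewrite mcoeffXU eqxx mcoeff0 oner_eq0.
pose G := chi`_a.
have Pa' : P`_a = G \mPo htrunc i.+1 by rewrite coef_map.
(* Truncation at [i] sends the variable [j] to 0, so of the equation for [P'] only its constant
   coefficient remains. *)
have G0 : G \mPo htrunc i = 0.
  have := congr1 (comp_mpoly (trunc i)) P'j.
  rewrite comp_mpoly0 -horner_map /= comp_mpolyXU -tnth_nth tnth_mktuple ltnn.
  by rewrite horner_coef0 coef_map /= P'0 Pa' htruncS.
have [d Gd] : exists d, pihomog mdeg d G \mPo htrunc i.+1 != 0.
  by apply: comp_pihomog_neq0; rewrite -Pa'.
exists (pihomog mdeg d G), d; split; [exact: pihomogP | | exact: Gd].
by rewrite -(pihomog_comp _ _ e0 (htrunc_homog i)) G0 pihomog0.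
Qed.

Lemma krull_lower q : (q <= n)%N -> exists Z, irreducible_chain pl_closed Y q Z.
Proof.
move=> qn; exists flag_image; split=> [i iq|i iq].
  by split; [apply: flag_image_closed | apply: flag_image_irreducible].
split; first exact: flag_image_sub.
have [G [d [hG G0 G1]]] := flag_separating (leq_trans iq qn).
have [v v0] := mpoly_neq0_nonzero_point G1; rewrite meval_htrunc => /eqP Gv.
have [t Zt vt] := flag_image_point i.+1 v0.
move=> /(_ t Zt)[_ /(_ G)] H; apply/Gv/(over_vanish vt hG)/H.
by split=> //; exists d.
Qed.

Lemma krull_dim_image : has_krull_dim pl_closed Y (n.+1%:Z - 1).
Proof.
have -> : n.+1%:Z - 1 = n%:Z by rewrite -addn1 PoszD addrK.
split=> [|q]; first by rewrite (Order.POrderTheory.le_trans (y := 0)).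
by rewrite lez_nat; split=> [[Z /krull_upper]|/krull_lower].
Qed.

End KrullOfImage.

(** * Images of powers and Pluecker coordinates *)

Section Minors.
Variables (k : fieldType) (M : vectType k).
Local Notation N := (\dim {:M}).
Local Notation e := (vbasis {:M}).

(** Images of basis vectors are rows, so composition reverses the order of products. *)
Definition lmx (f : 'End(M)) : 'M[k]_N := \matrix_(s, t) coord e t (f e`_s).

Lemma lmx1 : lmx \1%VF = 1%:M.
Proof.
apply/matrixP => s t; rewrite !mxE id_lfunE coord_free //.
exact: basis_free (vbasisP _).
Qed.

Lemma lmx_comp f g : lmx (f \o g)%VF = lmx g *m lmx f.
Proof.
apply/matrixP => s t; rewrite !mxE comp_lfunE.
rewrite {1}(coord_vbasis (memvf (g e`_s))) !linear_sum /=.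
by apply: eq_bigr => u _; rewrite !linearZ /= !mxE.
Qed.

Lemma lmx_sum (I : finType) (x : I -> k) (f : I -> 'End(M)) :
  lmx (\sum_i x i *: f i) = \sum_i x i *: lmx (f i).
Proof.
apply/matrixP => s t; rewrite mxE summxE sum_lfunE linear_sum /=.
by apply: eq_bigr => i _; rewrite !mxE scale_lfunE linearZ.
Qed.

Definition minor m n d (A : 'M[k]_(m, n)) (I : {ffun 'I_d -> 'I_n})
  (J : {ffun 'I_d -> 'I_m}) : k := \det (\matrix_(a, b) A (J a) (I b)).

Lemma row_full_minor m d (A : 'M[k]_(m, d)) : row_full A ->
  exists J : {ffun 'I_d -> 'I_m}, \det (\matrix_(a, b) A (J a) b) != 0.
Proof.
move=> Af; exists (fullrankfun Af); have := fullrowsub_unit Af.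
by rewrite unitmxE unitfE.
Qed.

(** The matrix of [f] factors through its image W as [C] times [B], where [B] is the matrix behind
    the Pluecker coordinates. The minors therefore factor as well, and c_J is a minor of [C]. *)
Lemma minor_pluecker d (f : 'End(M)) : \dim (limg f) = d ->
  exists c : {ffun 'I_d -> 'I_N} -> k,
  [/\ forall I J, minor (lmx f) I J = c J * pluecker (limg f) I,
      exists J, c J != 0 & exists I : {ffun 'I_d -> 'I_N}, pluecker (limg f) I != 0].
Proof.
case: d /; set W := limg f.
pose C := \matrix_(s < N, a < \dim W) coord (vbasis W) a (f e`_s).
pose B := \matrix_(a < \dim W, s < N) coord e s (vbasis W)`_a.
have freeW : free (vbasis W) := basis_free (vbasisP W).
have fW m : f m \in W by rewrite memv_img // memvf.
exists (fun J => \det (\matrix_(a, b) C (J a) b)); split.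
- move=> I J; rewrite -det_mulmx; congr (\det _); apply/matrixP => a b.
  rewrite !mxE {1}(coord_vbasis (fW e`_(J a))) linear_sum.
  by apply: eq_bigr => i _; rewrite linearZ /= !mxE.
(* Preimages under [f] of the basis vectors of [W] give a left inverse of [C]. *)
- apply: row_full_minor; apply/row_fullP.
  have /fin_all_exists[m mE] : forall a : 'I_(\dim W), exists m, (vbasis W)`_a = f m.
    move=> a; have /memv_imgP[m _ E] : (vbasis W)`_a \in limg f.
      by apply/vbasis_mem/memt_nth.
    by exists m.
  exists (\matrix_(a, s) coord e s (m a)); apply/matrixP => a b; rewrite !mxE.
  have := congr1 (coord (vbasis W) b) (mE a).
  rewrite coord_free // {1}(coord_vbasis (memvf (m a))) !linear_sum => ->.
  by apply: eq_bigr => s _; rewrite !mxE !linearZ.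
have [|I BI] := @row_full_minor _ _ B^T.
  (* Each [coord (vbasis W) a] is a linear functional on all of [M]; its values on the basis of [M]
     give a left inverse of the transpose of [B]. *)
  apply/row_fullP; exists (\matrix_(a, s) coord (vbasis W) a e`_s).
  apply/matrixP => a b; rewrite !mxE.
  have := congr1 (coord (vbasis W) a) (coord_vbasis (memvf (vbasis W)`_b)).
  rewrite coord_free // linear_sum eq_sym => ->.
  by apply: eq_bigr => s _; rewrite !mxE linearZ /= mulrC.
exists I; rewrite /pluecker -det_tr; move: BI; congr (_ != _).
by congr (\det _); apply/matrixP => a b; rewrite !mxE.
Qed.

End Minors.

Section Linearity.
Variables (k : fieldType) (p : nat) (g : vectType k) (L : restrictedLie g p).
Variables (M : vectType k) (MM : renv_module L M).

Lemma renvXD x y : renvX L (x + y) = renvX L x + renvX L y.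
Proof.
rewrite /renvX -qprojD; congr (qproj _ _); rewrite /envX -qprojD.
congr (qproj _ _); rewrite /tensorX -qprojD; apply/qprojP.
exact/IdealGen/TensorD.
Qed.

Lemma xM_sum (I : finType) (x : I -> k) (v : I -> g) :
  xM MM (\sum_i x i *: v i) = \sum_i x i *: xM MM (v i).
Proof.
have xMZ c y : xM MM (c *: y) = c *: xM MM y.
  by apply/lfunP => m; rewrite scale_lfunE !xME renvXZ uactA uactC.
have xMD : {morph xM MM : y z / y + z}.
  by move=> y z; apply/lfunP => m; rewrite add_lfunE !xME renvXD uactDl.
have xM0 : xM MM 0 = 0 by rewrite -(scale0r (0 : g)) xMZ scale0r.
by rewrite (big_morph _ xMD xM0); apply: eq_bigr => i _; apply: xMZ.
Qed.

End Linearity.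

(** * Minors of powers of a matrix of linear forms *)

Section GenericMatrix.
Variables (k : fieldType) (n N : nat) (A : 'I_n -> 'M[k]_N).

Definition generic_mx : 'M[{mpoly k[n]}]_N :=
  \matrix_(s, t) \sum_i A i s t *: 'X_i.

Fixpoint generic_pow j : 'M[{mpoly k[n]}]_N :=
  if j is j'.+1 then generic_pow j' *m generic_mx else 1%:M.

Definition generic_minor j d (I J : {ffun 'I_d -> 'I_N}) : {mpoly k[n]} :=
  \det (\matrix_(a, b) generic_pow j (J a) (I b)).

Lemma generic_mx_homog s t : generic_mx s t \is 1.-homog.
Proof.
rewrite mxE; apply: rpred_sum => i _; apply: dhomogZ.
by rewrite dhomogX /= mdeg1.
Qed.

Lemma generic_pow_homog j s t : generic_pow j s t \is j.-homog.
Proof.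
elim: j s t => [|j IH] s t /=; rewrite mxE.
  by case: eqP => _; [apply: dhomog1 | apply: dhomog0].
apply: rpred_sum => u _; rewrite -addn1.
by apply: dhomogM; [apply: IH | apply: generic_mx_homog].
Qed.

Lemma generic_minor_homog j d (I J : {ffun 'I_d -> 'I_N}) :
  generic_minor j I J \is (d * j).-homog.
Proof.
have hp (u : 'I_d -> 'I_d) :
    \prod_i (\matrix_(a, b) generic_pow j (J a) (I b)) i (u i) \is (d * j).-homog.
  have -> : (d * j)%N = (\sum_(i < d) j)%N by rewrite sum_nat_const card_ord.
  elim/big_ind2: _ => [|x1 x2 y1 y2 h1 h2|i _]; first exact: dhomog1.
    exact: dhomogM.
  by rewrite mxE; apply: generic_pow_homog.
apply: rpred_sum => s _; rewrite mulr_sign.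
by case: ifP => _; rewrite ?rpredN; apply: hp.
Qed.

Lemma meval_generic_pow x j :
  map_mx (meval x) (generic_pow j) = iter j (fun B => B *m \sum_i x i *: A i) 1%:M.
Proof.
elim: j => [|j IH] /=; first by rewrite map_mx1.
rewrite map_mxM IH; congr (_ *m _); apply/matrixP => s t.
rewrite !mxE summxE (raddf_sum (meval x)); apply: eq_bigr => i _ /=.
by rewrite mevalZ mevalXU mxE mulrC.
Qed.

Lemma meval_generic_minor x j d (I J : {ffun 'I_d -> 'I_N}) :
  (generic_minor j I J).@[x] =
  minor (iter j (fun B => B *m \sum_i x i *: A i) 1%:M) I J.
Proof.
rewrite -meval_generic_pow -[LHS]det_map_mx; congr (\det _).
by apply/matrixP => a b; rewrite !mxE.
Qed.

End GenericMatrix.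

Lemma meval_det2 (R : fieldType) n (x : 'I_n -> R) (a b c d : {mpoly R[n]}) :
  (a * b - c * d).@[x] = a.@[x] * b.@[x] - c.@[x] * d.@[x].
Proof. by rewrite mevalB !mevalM. Qed.

(** * The image map in coordinates on the nullcone *)

Section ImageMapDimension.
Variables (k : closedFieldType) (p : nat) (g : vectType k) (L : restrictedLie g p).
Variables (M : vectType k) (MM : renv_module L M).
Variables (V : {vspace g}) (hV : is_nullcone L V).
Variables (j d : nat) (hd : constant_jrank MM j d).
Local Notation Y := (range (im_map hV hd)).
Local Notation K := (#|{ffun 'I_d -> 'I_(\dim {:M})}|).

Lemma krull_dim_empty : \dim V = 0%N ->
  has_krull_dim (@gr_closed k M d) Y ((\dim V)%:Z - 1).
Proof.
move=> V0; rewrite V0; split=> // m; split=> [[Z [Zcl _]]|]; last by [].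
have [[C _ ZE] [[t Zt] _]] := Zcl 0%N isT.
exfalso; move: Zt; rewrite ZE => -[[l _ _] _].
case: l => l /= /andP[/dimvS]; rewrite V0 leqn0 => /eqP -> //.
Qed.

Variable n : nat.
Hypothesis Vn : \dim V = n.+1.

Definition Vvec (x : 'I_n.+1 -> k) : g := \sum_i x i *: (vbasis V)`_i.

Lemma Vvec_mem x : Vvec x \in V.
Proof.
apply: rpred_sum => i _; apply/rpredZ/vbasis_mem/mem_nth.
by rewrite size_tuple Vn.
Qed.

Lemma Vvec_surj v : v \in V -> exists x, v = Vvec x.
Proof.
move=> vV; have := coord_vbasis vV.
pose x (i : 'I_n.+1) := coord (vbasis V) (cast_ord (esym Vn) i) v.
move=> E; exists x; rewrite E /Vvec.
rewrite (reindex (cast_ord (esym Vn))) /=.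
  by apply: eq_bigr.
by exists (cast_ord Vn) => i _; rewrite ?cast_ordK ?cast_ordKV.
Qed.

Lemma Vvec_neq0 x : (exists i, x i != 0) <-> Vvec x != 0.
Proof.
split=> [[i xi]|]; last first.
  apply: contra_neqP => /forallNP x0; rewrite /Vvec big1 // => i _.
  by have /negP := x0 i; rewrite negbK => /eqP ->; rewrite scale0r.
apply: contra_neq xi => E.
have fr := basis_free (vbasisP V).
pose y (i : 'I_(\dim V)) := x (cast_ord Vn i).
have /freeP := fr => /(_ y); rewrite (reindex (cast_ord (esym Vn))) /=; last first.
  by exists (cast_ord Vn) => ? _; rewrite ?cast_ordK ?cast_ordKV.
rewrite -[RHS]E => /(_ _ (cast_ord (esym Vn) i)); rewrite /y cast_ordKV; apply.
by apply: eq_bigr => l _; rewrite /y cast_ordKV.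
Qed.

Let gmx i := lmx (xM MM (vbasis V)`_i).
Let F (i : 'I_K) (J : {ffun 'I_d -> 'I_(\dim {:M})}) : {mpoly k[n.+1]} :=
  generic_minor (fun l : 'I_n.+1 => gmx l) j (enum_val i) J.

Lemma lmx_xMpow x : lmx (xMpow MM j (Vvec x)) =
  iter j (fun B => B *m \sum_(i < n.+1) x i *: gmx i) 1%:M.
Proof.
rewrite /xMpow; elim: j => [|l IH] /=; first exact: lmx1.
by rewrite lmx_comp IH /Vvec xM_sum lmx_sum.
Qed.

Lemma minor_image x : (exists i, x i != 0) ->
  let W := limg (xMpow MM j (Vvec x)) in
  exists c, [/\ forall i J, (F i J).@[x] = c J * pluecker_pt (d := d) W i,
    exists J, c J != 0 & exists i, pluecker_pt (d := d) W i != 0].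
Proof.
move=> /Vvec_neq0 x0 W.
have dW : \dim W = d by apply: hd => //; apply/hV/Vvec_mem.
have [c [cE cJ [I PI]]] := minor_pluecker dW; exists c; split=> // [i J|].
  by rewrite /F meval_generic_minor -lmx_xMpow cE.
by exists (enum_rank I); rewrite /pluecker_pt enum_rankK.
Qed.

Lemma image_parametrization : exists e (h : K.-tuple {mpoly k[n.+1]}),
  [/\ forall i, tnth h i \is e.-homog,
   forall x : 'I_n.+1 -> k, (exists i, x i != 0) -> exists i, (tnth h i).@[x] != 0 &
   forall x t, (exists i, x i != 0) ->
     val t = limg (xMpow MM j (Vvec x)) ->
     lies_over (fun t : grassmannian M d => pluecker_pt (d := d) (val t)) h x t].
Proof.
have F0 (x : 'I_n.+1 -> k) : (exists i, x i != 0) -> exists i J, (F i J).@[x] != 0.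
  case/minor_image => c [cE [J cJ] [i Pi]]; exists i, J.
  by rewrite cE mulf_neq0.
have homF i J : F i J \is (d * j).-homog by apply: generic_minor_homog.
(* At every vector with nonzero coordinate 0 both sides equal c_J c_J' P_i P_i', and a nonzero
   difference would be nonzero at such a vector. *)
have rk1 i J i' J' : F i J * F i' J' = F i J' * F i' J.
  apply/eqP; rewrite -subr_eq0; apply/negPn/negP.
  move/mpoly_neq0_nonzero_point => [x x0]; case/negP.
  have [|c [cE _ _]] := @minor_image x; first by exists ord0.
  rewrite meval_det2 !cE; apply/eqP.
  by rewrite [X in _ - X]mulrACA [c J' * c J]mulrC -mulrACA subrr.
have [h [u [e [hh hu]]]] := homog_rank_one_factor homF F0 rk1.
exists e, [tuple h i | i < K]; split.
- by move=> i; rewrite tnth_mktuple.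
- move=> x /F0[i [J]]; rewrite hu mevalM mulf_eq0 negb_or => /andP[hi _].
  by exists i; rewrite tnth_mktuple.
move=> x t x0 tE; have [i [J FiJ]] := F0 x x0.
have [c [cE _ _]] := minor_image x0.
have : (F i J).@[x] != 0 by [].
rewrite {1}hu mevalM mulf_eq0 negb_or => /andP[hi uJ].
have cJ : c J != 0 by move: FiJ; rewrite cE mulf_eq0 negb_or => /andP[].
(* The scalar comes from comparing F = h u_J with F = c_J P at [x], for a [J] where both factors are
   nonzero. *)
exists (c J / (u J).@[x]); first by rewrite mulf_neq0 ?invr_eq0.
move=> i'; rewrite tnth_mktuple; apply: (mulIf uJ).
by rewrite -mevalM -hu cE tE mulrAC divfK.
Qed.

Lemma krull_dim_im_map : has_krull_dim (@gr_closed k M d) Y 0 \/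
  has_krull_dim (@gr_closed k M d) Y ((\dim V)%:Z - 1).
Proof.
have [e [h [homh h0 hover]]] := image_parametrization.
pose Pl (t : grassmannian M d) := pluecker_pt (d := d) (val t).
have Yover (x : 'I_n.+1 -> k) : (exists i, x i != 0) ->
    exists2 t, Y t & lies_over Pl h x t.
  move=> x0; have v0 : Vvec x != 0 by apply/Vvec_neq0.
  have lP : (<[Vvec x]> <= V)%VS && (\dim <[Vvec x]> == 1%N).
    by rewrite -memvE Vvec_mem dim_vline v0.
  pose l : proj_space V := exist _ <[Vvec x]>%VS lP.
  exists (im_map hV hd l); first by exists l.
  by apply: hover x0 _; apply: im_mapE v0 _.
have overY t : Y t -> exists2 x : 'I_n.+1 -> k,
    (exists i, x i != 0) & lies_over Pl h x t.
  case=> l _ <-; have /andP[lV /eqP dl] := valP l.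
  have /Vvec_surj[x xE] : vpick (val l) \in V by apply/(subvP lV)/memv_pick.
  have x0 : exists i, x i != 0.
    by apply/Vvec_neq0; rewrite -xE vpick0 -dimv_eq0 dl.
  by exists x; [exact: x0 | apply: hover x0 _; rewrite -xE].
have clE : @gr_closed k M d = pl_closed Pl by [].
rewrite clE; have [e0|e0] := posnP e.
  by left; apply: (krull_dim_const homh Yover overY e0).
by right; rewrite Vn; apply: (krull_dim_image homh h0 Yover overY e0).
Qed.

End ImageMapDimension.

Theorem lemma3p2p1 (k : closedFieldType) (p : nat) (hp : p \in [pchar k])
  (g : vectType k) (L : restrictedLie g p)
  (V : {vspace g}) (hV : is_nullcone L V)
  (j : nat) (hj : (1 <= j <= p.-1)%N)
  (M : vectType k) (MM : renv_module L M)
  (d : nat) (hd : constant_jrank MM j d) :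
  has_krull_dim (@gr_closed k M d) (range (im_map hV hd)) 0 \/
  has_krull_dim (@gr_closed k M d) (range (im_map hV hd)) ((\dim V)%:Z - 1).
Proof.
case E : (\dim V) => [|n]; rewrite -E.
  (* There is no line in the zero space, so the image is empty and has dimension -1 = dim V - 1. *)
  by right; apply: krull_dim_empty.
exact: krull_dim_im_map E.
Qed.
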